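(* Let $n$ be a non-negative integer and let $R$ be an $n$-Gorenstein ring with $\mathrm{id}(\mathrm{Flat}(R))<\infty$. Then the left global Ding projective dimension of $R$ is less than or equal to $n$, and it coincides with $\mathrm{id}({}_RR)$.
   Context: Rings are associative with unit; modules are left modules unless otherwise indicated. $\mathrm{Flat}(R)$ is the class of flat $R$-modules, $\mathrm{id}$ denotes injective dimension, and for a class $\mathcal{C}$ of modules $\mathrm{id}(\mathcal{C})=\sup\{\mathrm{id}(C):C\in\mathcal{C}\}$. A ring $R$ is $n$-Gorenstein if it is left and right Noetherian with $\mathrm{id}({}_RR)\le n$ and $\mathrm{id}(R_R)\le n$. An $R$-module $M$ is Ding projective if it is a cycle of an exact complex $P_\bullet$ (indexed by $\mathbb{Z}$) of projective $R$-modules such that $\mathrm{Hom}_R(P_\bullet,F)$ is exact for every flat $R$-module $F$. The Ding projective dimension of $M$ is the least $k\ge 0$ for which there is an exact sequence $0\to G_k\to\cdots\to G_0\to M\to 0$ with all $G_i$ Ding projective ($\infty$ if there is none). The left global Ding projective dimension of $R$ is the supremum of the Ding projective dimensions of all left $R$-modules. *)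

(* Defs.v *)
From HB Require Import structures.
From mathcomp Require Import all_boot all_algebra.
From mathcomp Require Import boolp freeg.

Set Implicit Arguments.
Unset Strict Implicit.
Unset Printing Implicit Defensive.

Import GRing.Theory.

Local Open Scope ring_scope.
Local Open Scope quotient_scope.

(* Rings are [pzRingType], so the zero ring is allowed.  Left R-modules are
   [lmodType R] and right R-modules are [lmodType R^c], with [r *: a] standing
   for the right action a.r. *)

(* Extended natural numbers; [None] is infinity. *)
Definition enat := option nat.

Definition enat_le (x y : enat) : bool :=
  match x, y with
  | _, None => true
  | None, Some _ => false
  | Some m, Some n => (m <= n)%N
  end.

(* [None] when no k satisfies P. *)
Definition enat_least (P : nat -> Prop) : enat :=
  if pselect (exists k, `[< P k >]) is left ex then Some (ex_minn ex) else None.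

Lemma enat_least_le (P : nat -> Prop) n :
  enat_le (enat_least P) (Some n) <-> exists2 k, (k <= n)%N & P k.
Proof.
rewrite /enat_least; case: pselect => [ex|nex] /=.
  case: ex_minnP => m /asboolP Pm minm; split=> [le_mn|[k le_kn Pk]].
    by exists m.
  by apply: leq_trans le_kn; apply: minm; apply/asboolP.
by split=> // -[k _ Pk]; case: nex; exists k; apply/asboolP.
Qed.

Definition enat_sup (S : enat -> Prop) : enat :=
  enat_least (fun k => forall x, S x -> enat_le x (Some k)).

Lemma enat_sup_le (S : enat -> Prop) (y : enat) :
  enat_le (enat_sup S) y <-> forall x, S x -> enat_le x y.
Proof.
case: y => [n|]; last by split=> [_ []|_] //; case: enat_sup.
rewrite enat_least_le; split=> [[k le_kn ub] x /ub|ub]; last by exists n.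
by case: x => //= m le_mk; apply: leq_trans le_kn.
Qed.

Section TensorProduct.
Variable R : pzRingType.
Implicit Types (A B : lmodType R^c) (F : lmodType R).

Definition tfree A F : zmodType := {freeg (A * F) / int}.

Definition tgen A F (a : A) (x : F) : tfree A F := << (a, x) >>.

(* The subgroup of the free abelian group on A x F whose quotient is the tensor
   product of A and F over R. *)
Inductive tensor_rel A F : tfree A F -> Prop :=
| tensor_rel_addl a a' x :
    tensor_rel (tgen (a + a') x - tgen a x - tgen a' x)
| tensor_rel_addr a x x' :
    tensor_rel (tgen a (x + x') - tgen a x - tgen a x')
| tensor_rel_scale (r : R) a x :
    tensor_rel (tgen ((r : R^c) *: a) x - tgen a (r *: x))
| tensor_rel_zero : tensor_rel 0
| tensor_rel_sub z z' : tensor_rel z -> tensor_rel z' -> tensor_rel (z - z').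

Definition tensor_relb A F : {pred tfree A F} :=
  fun z => `[< tensor_rel z >].

Lemma tensor_relb_zmod_closed A F : zmod_closed (@tensor_relb A F).
Proof.
split=> [|z z' /asboolP rz /asboolP rz']; apply/asboolP.
  exact: tensor_rel_zero.
exact: tensor_rel_sub.
Qed.

HB.instance Definition _ A F :=
  GRing.isZmodClosed.Build (tfree A F) (@tensor_relb A F)
    (@tensor_relb_zmod_closed A F).

Definition tensor A F : zmodType := Quotient.quot (@tensor_relb A F).

Definition tmul A F (a : A) (x : F) : tensor A F :=
  \pi_(Quotient.quot (@tensor_relb A F)) (tgen a x).

(* f tensor F, computed on a representative; see [tensor_map_tmul] and
   [tensor_map_is_zmod_morphism] below. *)
Definition tensor_map A B F (f : {linear A -> B}) (t : tensor A F) :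
    tensor B F :=
  fglift (fun p : A * F => tmul (f p.1) p.2 : zmodule (tensor B F))
    (repr (t : Quotient.quot (@tensor_relb A F))).

Lemma tensor_pi_eq A F (z z' : tfree A F) :
  tensor_rel (z - z') ->
  \pi_(Quotient.quot (@tensor_relb A F)) z = \pi z'.
Proof. by move=> rz; apply/eqP; rewrite -Quotient.idealrBE; apply/asboolP. Qed.

Lemma tmulDl A F (a a' : A) (x : F) :
  tmul (a + a') x = tmul a x + tmul a' x.
Proof.
rewrite /tmul -raddfD; apply: tensor_pi_eq; rewrite opprD addrA.
exact: tensor_rel_addl.
Qed.

Lemma tmulDr A F (a : A) (x x' : F) :
  tmul a (x + x') = tmul a x + tmul a x'.
Proof.
rewrite /tmul -raddfD; apply: tensor_pi_eq; rewrite opprD addrA.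
exact: tensor_rel_addr.
Qed.

Lemma tmulZ A F (r : R) (a : A) (x : F) :
  tmul ((r : R^c) *: a) x = tmul a (r *: x).
Proof. exact/tensor_pi_eq/tensor_rel_scale. Qed.

Section TensorMap.
Variables (A B : lmodType R^c) (F : lmodType R) (f : {linear A -> B}).

Let g := fun p : A * F => tmul (f p.1) p.2 : zmodule (tensor B F).

Let glift (z : tfree A F) : tensor B F := fglift g z.

Let glift_sub (z z' : tfree A F) : glift (z - z') = glift z - glift z'.
Proof. exact: (@lift_is_additive _ _ (zmodule (tensor B F)) g z z'). Qed.

Let gliftU a x : glift (tgen a x) = tmul (f a) x.
Proof. by rewrite /glift /tgen liftU scale1r. Qed.

Let glift_rel z : tensor_rel z -> glift z = 0.
Proof.
elim=> [a a' x|a x x'|r a x||u v _ u0 _ v0].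
- by rewrite !glift_sub !gliftU raddfD tmulDl addrAC addrK subrr.
- by rewrite !glift_sub !gliftU tmulDr addrAC addrK subrr.
- by rewrite glift_sub !gliftU linearZ tmulZ subrr.
- by rewrite -(subrr 0) glift_sub subrr.
- by rewrite glift_sub u0 v0 subrr.
Qed.

Lemma tensor_map_pi z :
  tensor_map f (\pi_(Quotient.quot (@tensor_relb A F)) z) = glift z.
Proof.
apply/eqP; rewrite -subr_eq0 -glift_sub; apply/eqP/glift_rel/asboolP.
rewrite -[X in is_true X]/(_ \in @tensor_relb A F).
by rewrite (Quotient.idealrBE (@tensor_relb A F)) reprK.
Qed.

Lemma tensor_map_tmul a (x : F) : tensor_map f (tmul a x) = tmul (f a) x.
Proof. by rewrite tensor_map_pi gliftU. Qed.

Lemma tensor_map_is_zmod_morphism : zmod_morphism (@tensor_map A B F f).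
Proof.
move=> t t'; rewrite -[t]reprK -[t']reprK -raddfB !tensor_map_pi.
exact: glift_sub.
Qed.

End TensorMap.
End TensorProduct.

Section Modules.
Variable R : pzRingType.
Implicit Types M N I P F : lmodType R.

(* Exactness at V of U -> V -> W. *)
Definition exact_at (U V W : lmodType R) (f : {linear U -> V})
    (g : {linear V -> W}) : Prop :=
  forall v, g v = 0 <-> exists u, f u = v.

Definition projective P : Prop :=
  forall (M N : lmodType R) (p : {linear M -> N}) (f : {linear P -> N}),
    (forall y, exists x, p x = y) ->
    exists h : {linear P -> M}, forall x, p (h x) = f x.

Definition injective_module I : Prop :=
  forall (M N : lmodType R) (j : {linear M -> N}) (f : {linear M -> I}),
    injective j -> exists h : {linear N -> I}, forall x, h (j x) = f x.

Definition flat F : Prop :=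
  forall (A B : lmodType R^c) (f : {linear A -> B}),
    injective f -> injective (@tensor_map R A B F f).

(* An exact sequence 0 -> G_k -> ... -> G_0 -> M -> 0 with all G_i in C is
   stored as an infinite one with G_i = 0 for i > k. *)
Definition has_left_resolution (C : lmodType R -> Prop) M (k : nat) : Prop :=
  exists (G : nat -> lmodType R) (d : forall i, {linear G i.+1 -> G i})
         (e : {linear G 0 -> M}),
    [/\ forall i, (i <= k)%N -> C (G i),
        forall i, (k < i)%N -> forall x : G i, x = 0,
        forall y, exists x, e x = y,
        exact_at (d 0) e
      & forall i, exact_at (d i.+1) (d i)].

(* Dually, 0 -> M -> I_0 -> ... -> I_k -> 0. *)
Definition has_right_resolution (C : lmodType R -> Prop) M (k : nat) : Prop :=
  exists (I : nat -> lmodType R) (d : forall i, {linear I i -> I i.+1})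
         (e : {linear M -> I 0}),
    [/\ forall i, (i <= k)%N -> C (I i),
        forall i, (k < i)%N -> forall x : I i, x = 0,
        injective e,
        exact_at e (d 0)
      & forall i, exact_at (d i) (d i.+1)].

Definition inj_dim M : enat :=
  enat_least (has_right_resolution injective_module M).

Definition class_inj_dim (C : lmodType R -> Prop) : enat :=
  enat_sup (fun x => exists2 M, C M & x = inj_dim M).

(* The complex ... -> P_(i+1) -> P_i -> ...; M is a cycle of it when M is
   isomorphic to the kernel of some differential. *)
Definition ding_projective M : Prop :=
  exists (P : int -> lmodType R) (d : forall i : int, {linear P (i + 1) -> P i}),
    [/\ forall i, projective (P i),
        forall i, exact_at (d (i + 1)) (d i),
        forall F, flat F -> forall (i : int) (f : {linear P (i + 1) -> F}),
          (forall x, f (d (i + 1) x) = 0) <->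
          exists g : {linear P i -> F}, forall x, g (d i x) = f x
      & exists (i : int) (j : {linear M -> P (i + 1)}),
          injective j /\ exact_at j (d i)].

Definition ding_proj_dim M : enat :=
  enat_least (has_left_resolution ding_projective M).

Definition submodule M (S : M -> Prop) : Prop :=
  [/\ S 0, forall x y, S x -> S y -> S (x + y)
    & forall (r : R) x, S x -> S (r *: x)].

(* Ascending chain condition on submodules. *)
Definition noetherian_module M : Prop :=
  forall S : nat -> M -> Prop,
    (forall i, submodule (S i)) ->
    (forall i x, S i x -> S i.+1 x) ->
    exists m, forall i x, (m <= i)%N -> S i x -> S m x.

End Modules.

Definition left_noetherian (R : pzRingType) : Prop :=
  noetherian_module (R^o : lmodType R).

Definition right_noetherian (R : pzRingType) : Prop :=
  noetherian_module ((R^c)^o : lmodType R^c).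

Definition gorenstein (n : nat) (R : pzRingType) : Prop :=
  [/\ left_noetherian R, right_noetherian R,
      enat_le (inj_dim (R^o : lmodType R)) (Some n)
    & enat_le (inj_dim ((R^c)^o : lmodType R^c)) (Some n)].

Definition left_global_ding_proj_dim (R : pzRingType) : enat :=
  enat_sup (fun x => exists M : lmodType R, x = ding_proj_dim M).

(* Main.v *)
From HB Require Import structures.
Require Import Defs.
From mathcomp Require Import all_boot all_algebra.
From mathcomp Require Import boolp functions.
From mathcomp Require freeg classical_sets.

(** Write s for id(_R R), which is at most n.

    When every flat module has finite injective dimension, a module is Ding
    projective as soon as it is a cycle of an exact complex P of projective
    modules: a cycle of P is a k-th syzygy for every k, so Ext^1 from it to a
    module of finite injective dimension vanishes ([syzygy_ext]), and this is
    the exactness of Hom(P, F) for flat F ([projective_chain_ding]).  For the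
    upper bound it is therefore enough to extend the s-th syzygy of every
    module M to such a complex.  To the left one takes projective covers.  To
    the right one embeds M in an injective module I with cokernel M'.  The
    horseshoe construction yields an exact sequence 0 -> K -> L -> K' -> 0 of
    s-th syzygies of M, I and M', and L is projective because I has projective
    dimension at most s, so that one can go on with K'.

    That injective modules I have projective dimension at most s is the heart
    of the matter ([injective_syzygy_projective]), and it is where the
    hypotheses on R are used.
    - Since R is right Noetherian and id(R_R) <= n, the module
      Tor_i(R/J, I) = Hom(Ext^i(R/J, R), I) is zero for every right ideal J and
      every i > n, so that all syzygies of I from the n-th on are flat
      ([syzygy_flat]).
    - Flat modules have injective dimension at most some m.  Hence Ext^1 from
      the (s + n + m)-th syzygy of I to the next one is zero, the sequence that
      joins them splits, and this syzygy is projective.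
    - Since R is left Noetherian, free modules have injective dimension at most
      s ([fsup_inj_dim]).  The same splitting argument then shows that the
      k-th syzygies are projective once the next ones are, for k >= s.

    Conversely, if all Ding projective dimensions are at most g, then Ext^i(-, R)
    vanishes for i > g because it vanishes on Ding projective modules, and an
    injective resolution of R, which is known to be finite, can be shortened to
    length g ([inj_dim_descend]).

    The relations among Ext groups are used only in low degree, and are
    expressed by extensions of linear maps ([ext_vanish]) and by syzygies and
    cosyzygies. *)

Set Implicit Arguments.
Unset Strict Implicit.
Unset Printing Implicit Defensive.

Import GRing.Theory.

Local Open Scope ring_scope.
Local Open Scope quotient_scope.

(** * Submodules, quotients and factorization of linear maps *)

Section LinearTools.
Variable R : pzRingType.
Implicit Types U V W X Y Z M N A B C E F G I P K L Q : lmodType R.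

Definition mklin U V (f : U -> V) (lf : linear f) : {linear U -> V} :=
  HB.pack f (GRing.isLinear.Build R U V *:%R f lf).

Lemma mklinE U V (f : U -> V) (lf : linear f) x : mklin lf x = f x.
Proof. by []. Qed.

Section Sub.
Variables (M : lmodType R) (S : M -> Prop) (hS : submodule S).

(** The vacuous dependence on [hS] lets the module structure of [submod] below
    be inferred from its type. *)
Definition submod_pred : {pred M} := let _ := hS in fun x => `[< S x >].

Lemma submod_predP : GRing.submod_closed submod_pred.
Proof.
case: hS => S0 SD SZ; split=> [|a x y /asboolP Sx /asboolP Sy]; apply/asboolP => //.
by apply: SD => //; apply: SZ.
Qed.

HB.instance Definition _ := GRing.isSubmodClosed.Build R M submod_pred submod_predP.

Record submod := Submod { submod_val :> M; _ : submod_val \in submod_pred }.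
HB.instance Definition _ := [isSub for submod_val].
HB.instance Definition _ := [Choice of submod by <:].
HB.instance Definition _ := [SubChoice_isSubLmodule of submod by <:].

Lemma submodule_module :
  exists (N : lmodType R) (i : {linear N -> M}),
    injective i /\ forall x, S x <-> exists u, i u = x.
Proof.
exists (submod : lmodType R), (\val : {linear submod -> M}).
split; first exact: val_inj.
move=> x; split=> [Sx|[[u /asboolP Su] <-]] //.
have Px : x \in submod_pred by apply/asboolP.
by exists (Submod Px).
Qed.

Definition quotmod : Type := Quotient.quot submod_pred.
HB.instance Definition _ := GRing.Zmodule.on quotmod.

Definition quot_pi (x : M) : quotmod := \pi_(Quotient.quot submod_pred) x.

Lemma quot_piE x y : quot_pi x = quot_pi y <-> S (x - y).
Proof.
split=> [/eqP|Sxy]; last apply/eqP; rewrite /quot_pi -Quotient.idealrBE.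
  by move/asboolP.
exact/asboolP.
Qed.

Definition quot_scale (r : R) (t : quotmod) : quotmod :=
  quot_pi (r *: repr (t : Quotient.quot submod_pred)).

Lemma quot_scale_pi r x : quot_scale r (quot_pi x) = quot_pi (r *: x).
Proof.
have [_ _ SZ] := hS.
apply/quot_piE; rewrite -scalerBr; apply: SZ; apply/quot_piE.
by rewrite /quot_pi reprK.
Qed.

Lemma quot_piD x y : quot_pi (x + y) = quot_pi x + quot_pi y.
Proof. exact: raddfD. Qed.

Lemma quot_pi_surj (t : quotmod) : exists x, quot_pi x = t.
Proof. by exists (repr (t : Quotient.quot submod_pred)); rewrite /quot_pi reprK. Qed.

Lemma quot_scaleA a b t : quot_scale a (quot_scale b t) = quot_scale (a * b) t.
Proof. by have [x <-] := quot_pi_surj t; rewrite !quot_scale_pi scalerA. Qed.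
Lemma quot_scale1 : left_id 1 quot_scale.
Proof. by move=> t; have [x <-] := quot_pi_surj t; rewrite quot_scale_pi scale1r. Qed.
Lemma quot_scaleDr : right_distributive quot_scale +%R.
Proof.
move=> a t u; have [x <-] := quot_pi_surj t; have [y <-] := quot_pi_surj u.
by rewrite -quot_piD !quot_scale_pi scalerDr quot_piD.
Qed.
Lemma quot_scaleDl t : {morph quot_scale^~ t : a b / a + b}.
Proof.
move=> a b; have [x <-] := quot_pi_surj t.
by rewrite !quot_scale_pi scalerDl quot_piD.
Qed.

HB.instance Definition _ := GRing.Zmodule_isLmodule.Build R quotmod
  quot_scaleA quot_scale1 quot_scaleDr quot_scaleDl.

Lemma quotient_module :
  exists (N : lmodType R) (p : {linear M -> N}),
    (forall y, exists x, p x = y) /\ forall x, p x = 0 <-> S x.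
Proof.
have lp : linear quot_pi by move=> a x y; rewrite quot_piD -quot_scale_pi.
exists (quotmod : lmodType R), (mklin lp); split; first exact: quot_pi_surj.
move=> x; rewrite mklinE (_ : 0 = quot_pi 0); last by rewrite /quot_pi raddf0.
by split=> [/quot_piE|Sx]; [|apply/quot_piE]; rewrite subr0.
Qed.
End Sub.

Definition surj_map U V (p : {linear U -> V}) := forall y, exists x, p x = y.

Definition ses X Y Z (j : {linear X -> Y}) (p : {linear Y -> Z}) :=
  [/\ injective j, surj_map p & exact_at j p].

Lemma inj0P X Y (j : {linear X -> Y}) :
  (forall x, j x = 0 -> x = 0) -> injective j.
Proof.
move=> j0 x y /eqP; rewrite -subr_eq0 -raddfB => /eqP/j0/eqP.
by rewrite subr_eq0 => /eqP.
Qed.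

Lemma factor_mono X Y M (j : {linear X -> M}) (g : {linear Y -> M}) :
  injective j -> (forall y, exists x, j x = g y) ->
  exists h : {linear Y -> X}, forall y, j (h y) = g y.
Proof.
move=> jI gj; have [h hE] := choice gj.
have lh : linear h by move=> a x y; apply: jI; rewrite linearP !hE linearP.
by exists (mklin lh).
Qed.

Lemma factor_epi Y Z M (p : {linear Y -> Z}) (g : {linear Y -> M}) :
  surj_map p -> (forall y, p y = 0 -> g y = 0) ->
  exists h : {linear Z -> M}, forall y, h (p y) = g y.
Proof.
move=> pS gp; have [r rE] := choice pS.
have gE y : g (r (p y)) = g y.
  apply/eqP; rewrite -subr_eq0; apply/eqP.
  by have := gp (r (p y) - y); rewrite !raddfB /= rE subrr; apply.
have lh : linear (g \o r).
  move=> a x y /=; transitivity (g (a *: r x + r y)); last by rewrite linearP.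
  by rewrite -[RHS]gE linearP !rE.
by exists (mklin lh).
Qed.

Lemma kernel_exists Y Z (p : {linear Y -> Z}) :
  exists (K : lmodType R) (j : {linear K -> Y}), injective j /\ exact_at j p.
Proof.
have sK : submodule (fun y => p y = 0).
  split=> [|x y px py|r x px]; first exact: raddf0.
    by rewrite linearD px py addr0.
  by rewrite linearZ /= px scaler0.
have [K [j [jI jE]]] := submodule_module sK.
by exists K, j.
Qed.

Lemma cokernel_exists X Y (j : {linear X -> Y}) :
  exists (C : lmodType R) (p : {linear Y -> C}), surj_map p /\ exact_at j p.
Proof.
have sK : submodule (fun y => exists x, j x = y).
  split=> [|y y' [x <-] [x' <-]|r y [x <-]]; first by exists 0; rewrite raddf0.
    by exists (x + x'); rewrite linearD.
  by exists (r *: x); rewrite linearZ.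
have [C [p [pS pE]]] := quotient_module sK.
by exists C, p.
Qed.

Lemma pullback_exists A B C (f : {linear A -> C}) (g : {linear B -> C}) :
  exists (E : lmodType R) (a : {linear E -> A}) (b : {linear E -> B}),
    [/\ forall e, f (a e) = g (b e),
        forall x y, f x = g y -> exists e, a e = x /\ b e = y
      & forall e, a e = 0 -> b e = 0 -> e = 0].
Proof.
have sE : submodule (fun z : A * B => f z.1 = g z.2).
  split=> [|x y fx fy|r x fx] /=; first by rewrite !raddf0.
    by rewrite !linearD fx fy.
  by rewrite !linearZ /= fx.
have [E [i [iI iE]]] := submodule_module sE.
exists E, (fst \o i), (snd \o i); split=> /= [e|x y fxy|e e1 e2].
- by apply/iE; exists e.
- by have /iE[e ie] : f (x, y).1 = g (x, y).2 by []; exists e; rewrite ie.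
- by apply: iI; rewrite raddf0 [LHS]surjective_pairing e1 e2.
Qed.

End LinearTools.

(** * Finitely supported functions and free modules *)

Section FinSupp.
Variables (R : pzRingType) (X : eqType).
Implicit Types M N A B C : lmodType R.

Definition supported M (s : seq X) (f : X -> M) := forall x, x \notin s -> f x = 0.

Lemma finite_support_submodule M :
  submodule (fun f : X -> M => exists s, supported s f).
Proof.
split=> [|f g [s fs] [t gt]|r f [s fs]]; first by exists [::].
  exists (s ++ t) => x; rewrite mem_cat negb_or => /andP[/fs fx /gt gx].
  by rewrite -[LHS]/(f x + g x) fx gx addr0.
by exists s => x /fs fx; rewrite -[LHS]/(r *: f x) fx scaler0.
Qed.

(** The direct sum of copies of [M] indexed by [X]; it is free when [M] is the ring. *)
Definition fsup M : lmodType R := submod (finite_support_submodule M).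

Definition fsup_fun M (v : fsup M) : X -> M := submod_val v.

Lemma fsupD M (v w : fsup M) x : fsup_fun (v + w) x = fsup_fun v x + fsup_fun w x.
Proof. by []. Qed.

Lemma fsupZ M a (v : fsup M) x : fsup_fun (a *: v) x = a *: fsup_fun v x.
Proof. by []. Qed.

Lemma fsup_ext M (v w : fsup M) : fsup_fun v =1 fsup_fun w -> v = w.
Proof. by move=> vw; apply: val_inj; apply/funext. Qed.

Lemma fsup_finite M (v : fsup M) : exists2 s, uniq s & supported s (fsup_fun v).
Proof.
case: v => f fP; have /asboolP[s fs] := fP.
exists (undup s); first exact: undup_uniq.
by move=> x; rewrite mem_undup; apply: fs.
Qed.

Lemma fsup_mk M (f : X -> M) s : supported s f -> exists v : fsup M, fsup_fun v =1 f.
Proof.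
move=> fs; have fP : f \in submod_pred (finite_support_submodule M).
  by apply/asboolP; exists s.
by exists (Submod fP).
Qed.

Lemma fsup_sum M I (r : seq I) (F : I -> fsup M) x :
  fsup_fun (\sum_(i <- r) F i) x = \sum_(i <- r) fsup_fun (F i) x.
Proof.
by elim/big_rec2: _ => [|i a b _ <-]; rewrite ?fsupD.
Qed.

Definition single_fun M (x : X) (m : M) y := if y == x then m else 0.

Lemma single_supported M x (m : M) : supported [:: x] (single_fun x m).
Proof. by move=> y; rewrite inE /single_fun => /negbTE ->. Qed.

Definition single M x (m : M) : fsup M :=
  projT1 (cid (fsup_mk (@single_supported M x m))).

Lemma singleE M x (m : M) y : fsup_fun (single x m) y = if y == x then m else 0.
Proof. by rewrite /single; case: cid. Qed.

Lemma fsup_decomp M (v : fsup M) s :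
  uniq s -> supported s (fsup_fun v) -> v = \sum_(x <- s) single x (fsup_fun v x).
Proof.
move=> us vs; apply: fsup_ext => y; rewrite fsup_sum.
have [ys|ys] := boolP (y \in s).
  rewrite (bigD1_seq y) //= singleE eqxx big1 ?addr0 // => x xy.
  by rewrite singleE eq_sym (negbTE xy).
rewrite vs // big_seq big1 // => x xs; rewrite singleE; case: eqP => // yx.
by rewrite yx xs in ys.
Qed.

Lemma big_supported (V : nmodType) (F : X -> V) s t : uniq s -> uniq t ->
  (forall x, x \notin s -> F x = 0) -> (forall x, x \notin t -> F x = 0) ->
  \sum_(x <- s) F x = \sum_(x <- t) F x.
Proof.
move=> us ut Fs Ft; rewrite [LHS](bigID (mem t)) [RHS](bigID (mem s)) /=.
rewrite [X in _ + X]big1 => [|x /Ft //]; rewrite [X in _ = _ + X]big1 => [|x /Fs //].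
rewrite !addr0 -[LHS]big_filter -[RHS]big_filter; apply/perm_big/uniq_perm.
- exact: filter_uniq.
- exact: filter_uniq.
by move=> x; rewrite !mem_filter andbC.
Qed.

Lemma fsup_lift M N (g : X -> {linear M -> N}) :
  exists h : {linear fsup M -> N}, forall x m, h (single x m) = g x m.
Proof.
pose supp v := projT1 (cid2 (@fsup_finite M v)).
have us v : uniq (supp v) by rewrite /supp; case: cid2.
have ss v : supported (supp v) (fsup_fun v) by rewrite /supp; case: cid2.
pose h v := \sum_(x <- supp v) g x (fsup_fun v x).
have hE v s : uniq s -> supported s (fsup_fun v) ->
    h v = \sum_(x <- s) g x (fsup_fun v x).
  move=> us' ss'; apply: big_supported => // x xs; first by rewrite ss ?linear0.
  by rewrite ss' ?linear0.
have lh : linear h.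
  move=> a v w; pose s := undup (supp v ++ supp w).
  have sv : supported s (fsup_fun v).
    by move=> x; rewrite mem_undup mem_cat negb_or => /andP[/ss].
  have sw : supported s (fsup_fun w).
    by move=> x; rewrite mem_undup mem_cat negb_or => /andP[_ /ss].
  have su : uniq s by exact: undup_uniq.
  rewrite !(hE _ s) // => [|x xs]; last by rewrite fsupD fsupZ sv // sw // scaler0 addr0.
  rewrite scaler_sumr -big_split; apply: eq_bigr => x _.
  by rewrite fsupD fsupZ linearP.
exists (mklin lh) => x m; rewrite mklinE (hE _ [:: x]) //.
  by rewrite big_seq1 singleE eqxx.
by move=> y; rewrite inE singleE => /negbTE ->.
Qed.

Lemma fsup_eq M N (f g : {linear fsup M -> N}) :
  (forall x m, f (single x m) = g (single x m)) -> f =1 g.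
Proof.
move=> fg v; have [s us vs] := fsup_finite v.
by rewrite (fsup_decomp us vs) !linear_sum; apply: eq_bigr.
Qed.

Lemma fsup_projective : projective (fsup (R^o : lmodType R)).
Proof.
move=> A B p f pS; have [a aE] := choice (fun x => pS (f (single (M := R^o) x 1))).
have lg x : linear (fun r : R^o => r *: a x) by move=> b r s; rewrite scalerDl scalerA.
have [h hE] := fsup_lift (fun x => mklin (lg x)); exists h.
apply: (@fsup_eq _ _ (p \o h) f) => x r /=.
have -> : single x r = (r : R) *: single (M := R^o) x 1.
  apply: fsup_ext => y; rewrite fsupZ !singleE; case: eqP => _; last by rewrite scaler0.
  exact/esym/mulr1.
by rewrite !linearZ /= hE mklinE scale1r aE.
Qed.

Lemma fsup_map M N (f : {linear M -> N}) :
  exists h : {linear fsup M -> fsup N}, forall v x, fsup_fun (h v) x = f (fsup_fun v x).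
Proof.
have fv v : exists w : fsup N, fsup_fun w =1 (fun x => f (fsup_fun v x)).
  have [s _ vs] := fsup_finite v.
  by apply: (fsup_mk (s := s)) => x /vs ->; rewrite linear0.
have [h hE] := choice fv.
have lh : linear h.
  by move=> a v w; apply: fsup_ext => x; rewrite fsupD fsupZ !hE fsupD fsupZ linearP.
by exists (mklin lh).
Qed.

(** Exactness is checked at each index; preimages are chosen to be 0 outside a
    finite set that supports the given function, so that they have finite
    support too. *)
Lemma fsup_ses M N C (j : {linear M -> N}) (p : {linear N -> C}) : ses j p ->
  exists (j' : {linear fsup M -> fsup N}) (p' : {linear fsup N -> fsup C}), ses j' p'.
Proof.
move=> [jI pS jp]; have [j' j'E] := fsup_map j; have [p' p'E] := fsup_map p.
have lift (K L : lmodType R) (f : {linear K -> L}) (v : fsup L) :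
    (forall x, exists k, f k = fsup_fun v x) ->
    exists w : fsup K, forall x, f (fsup_fun w x) = fsup_fun v x.
  move=> fv; have [s _ vs] := fsup_finite v.
  have /choice[w wE] x : exists k, f k = fsup_fun v x /\ (x \notin s -> k = 0).
    have [xs|xs] := boolP (x \in s); first by have [k kE] := fv x; exists k; rewrite kE.
    by exists 0; rewrite linear0 vs.
  have ws : supported s w by move=> x xs; apply: (wE x).2.
  have [w' w'E] := fsup_mk ws; exists w' => x; rewrite w'E; exact: (wE x).1.
exists j', p'; split=> [v w vw|v|v].
- by apply: fsup_ext => x; apply: jI; rewrite -!j'E vw.
- by have [|w wE] := lift _ _ p v => //; exists w; apply: fsup_ext => x; rewrite p'E.
split=> [p0|[u <-]]; last first.
  by apply: fsup_ext => x; rewrite p'E j'E; apply/jp; exists (fsup_fun u x).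
have [|u uE] := lift _ _ j v; last by exists u; apply: fsup_ext => x; rewrite j'E.
by move=> x; apply/jp; rewrite -p'E p0.
Qed.

End FinSupp.

Lemma free_cover (R : pzRingType) (M : lmodType R) :
  exists p : {linear fsup M (R^o : lmodType R) -> M}, surj_map p.
Proof.
have lg (m : M) : linear (fun r : R^o => (r : R) *: m).
  by move=> b r s; rewrite scalerDl scalerA.
have [h hE] := fsup_lift (fun m => mklin (lg m)); exists h => m.
by exists (single (M := R^o) m 1); rewrite hE mklinE scale1r.
Qed.

(** * Short exact sequences, extensions and syzygies *)

Section Homological.
Variable R : pzRingType.
Implicit Types U V W X Y Z M N A B C E F G I P K L Q : lmodType R.

(** Ext^1(A, B) = 0, in the form of the long exact sequence: for a submodule
    with quotient [A], linear maps to [B] extend. *)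
Definition ext_vanish A B :=
  forall X Y (j : {linear X -> Y}) (p : {linear Y -> A}), ses j p ->
  forall f : {linear X -> B}, exists g : {linear Y -> B}, forall x, g (j x) = f x.

Fixpoint inj_dim_le k M : Prop :=
  if k is k'.+1 then
    exists I N (j : {linear M -> I}) (p : {linear I -> N}),
      [/\ injective_module I, ses j p & inj_dim_le k' N]
  else injective_module M.

(** [syzygy A k K]: [K] is the [k]-th kernel in the beginning of some projective
    resolution of [A]. *)
Inductive syzygy A : nat -> lmodType R -> Prop :=
| syzygy0 : syzygy A 0 A
| syzygyS k K P L (j : {linear L -> P}) (p : {linear P -> K}) :
    syzygy A k K -> projective P -> ses j p -> syzygy A k.+1 L.

(** [C] is a [k]-th cokernel in the beginning of an injective resolution of some
    module. *)
Fixpoint cosyzygy k C : Prop :=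
  if k is k'.+1 then
    exists K I (j : {linear K -> I}) (p : {linear I -> C}),
      [/\ cosyzygy k' K, injective_module I & ses j p]
  else True.

Definition retract X Y := exists (i : {linear X -> Y}) (r : {linear Y -> X}),
  forall x, r (i x) = x.

Lemma ses_comp0 X Y Z (j : {linear X -> Y}) (p : {linear Y -> Z}) :
  ses j p -> forall x, p (j x) = 0.
Proof. by case=> _ _ jp x; apply/jp; exists x. Qed.

Lemma ses_kernel Y Z (p : {linear Y -> Z}) : surj_map p ->
  exists K (j : {linear K -> Y}), ses j p.
Proof. by have [K [j [jI jp]]] := kernel_exists p; exists K, j. Qed.

Lemma ses_cokernel X Y (j : {linear X -> Y}) : injective j ->
  exists C (p : {linear Y -> C}), ses j p.
Proof. by have [K [p [jI jp]]] := cokernel_exists j; exists K, p. Qed.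

Lemma retract_projective X Y : retract X Y -> projective Y -> projective X.
Proof.
move=> [i [r ri]] projY A B p f pS.
have [h hE] := projY _ _ p (f \o r) pS.
by exists (h \o i) => x /=; rewrite hE /= ri.
Qed.

Lemma retract_injective X Y : retract X Y -> injective_module Y -> injective_module X.
Proof.
move=> [i [r ri]] injY A B j f jI.
have [h hE] := injY _ _ j (i \o f) jI.
by exists (r \o h) => x /=; rewrite hE /= ri.
Qed.

Lemma ext_retract A B C : retract C B -> ext_vanish A B -> ext_vanish A C.
Proof.
move=> [i [r ri]] eAB X Y j p jp f.
have [g gE] := eAB _ _ j p jp (i \o f).
by exists (r \o g) => x /=; rewrite gE /= ri.
Qed.

Lemma ext_injective A B : injective_module B -> ext_vanish A B.
Proof. by move=> injB X Y j p [jI _ _] f; apply: injB. Qed.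

Definition is_pullback E A B C (f : {linear A -> C}) (g : {linear B -> C})
    (a : {linear E -> A}) (b : {linear E -> B}) :=
  [/\ forall e, f (a e) = g (b e),
      forall x y, f x = g y -> exists e, a e = x /\ b e = y
    & forall e, a e = 0 -> b e = 0 -> e = 0].

Lemma is_pullback_sym E A B C (f : {linear A -> C}) (g : {linear B -> C})
    (a : {linear E -> A}) (b : {linear E -> B}) :
  is_pullback f g a b -> is_pullback g f b a.
Proof.
move=> [abE abX ab0]; split=> [//|x y /esym/abX[e [ae be]]|e b0 a0]; last exact: ab0.
by exists e.
Qed.

Lemma pullback_ses E X Y A G (j : {linear X -> Y}) (p : {linear Y -> A})
    (q : {linear G -> A}) (a : {linear E -> Y}) (b : {linear E -> G}) :
  is_pullback p q a b -> ses j p ->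
  exists2 i : {linear X -> E}, ses i b & forall x, a (i x) = j x.
Proof.
move=> [abE abX ab0] jp; have [jI pS jpE] := jp.
have /choice[i iE] x : exists e, a e = j x /\ b e = 0.
  by apply: abX; rewrite linear0 (ses_comp0 jp).
have abI e e' : a e = a e' -> b e = b e' -> e = e'.
  move=> ae be; apply/eqP; rewrite -subr_eq0; apply/eqP; apply: ab0.
    by rewrite linearB ae subrr.
  by rewrite linearB be subrr.
have li : linear i.
  move=> r x y; have [ax bx] := iE x; have [ay b_y] := iE y.
  have [axy bxy] := iE (r *: x + y).
  by apply: abI; rewrite linearP ?axy ?bxy ?ax ?bx ?ay ?b_y ?linearP // scaler0 addr0.
exists (mklin li); last by move=> x; case: (iE x).
split=> [x y ixy|g|e].
- by apply: jI; rewrite -(iE x).1 -(iE y).1 -[i x]/(mklin li x) ixy.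
- by have [y yE] := pS (q g); have [e [_ be]] := abX _ _ yE; exists e.
split=> [be|[x <-]]; last by case: (iE x).
have [|x jx] := (jpE (a e)).1; first by rewrite abE be linear0.
by exists x; apply: abI; have [ax bx] := iE x; rewrite mklinE ?ax ?bx ?be.
Qed.

(** The segment Hom(G, B) -> Hom(N, B) -> Ext^1(A, B) -> Ext^1(G, B) of the long
    exact sequence.  Given an extension of [A] by [X], the pullback along
    [G -> A] is an extension of [G], so [f] extends to it; the extension is then
    corrected so as to vanish on [N]. *)
Lemma ext_of_cover N G A B (i : {linear N -> G}) (q : {linear G -> A}) :
  ses i q -> ext_vanish G B ->
  (forall f : {linear N -> B}, exists g : {linear G -> B}, forall x, g (i x) = f x) ->
  ext_vanish A B.
Proof.
move=> iq eGB extN X Y j p jp f.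
have [E [a [b pb]]] := pullback_exists p q.
have [k kb ak] := pullback_ses pb jp.
have [l la bl] := pullback_ses (is_pullback_sym pb) iq.
have [h hE] := eGB _ _ k b kb f.
have [g gE] := extN (h \o l).
have [_ aS laE] := la.
have [|u uE] := @factor_epi _ _ _ _ a (h \- (g \o b)) aS.
  by move=> e /laE[n <-] /=; rewrite bl gE subrr.
by exists u => x; rewrite -ak uE /= hE (ses_comp0 kb) linear0 subr0.
Qed.

(** The dual reading of the vanishing of Ext^1: the pullback of the extension
    along [f] splits. *)
Lemma ext_lift A B Y Z (j : {linear B -> Y}) (p : {linear Y -> Z})
    (f : {linear A -> Z}) :
  ses j p -> ext_vanish A B -> exists g : {linear A -> Y}, forall x, p (g x) = f x.
Proof.
move=> jp eAB.
have [E [a [b pb]]] := pullback_exists p f.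
have [k kb ak] := pullback_ses pb jp.
have [r rE] := eAB _ _ k b kb idfun.
have [_ bS kbE] := kb.
have [|u uE] := @factor_epi _ _ _ _ b (a \- (j \o r)) bS.
  by move=> e /kbE[n <-] /=; rewrite rE ak subrr.
exists u => x; have [e <-] := bS x; have [abE _ _] := pb.
by rewrite uE linearB /= (ses_comp0 jp) subr0 abE.
Qed.

Lemma ext_split_quotient A B Y (j : {linear B -> Y}) (p : {linear Y -> A}) :
  ses j p -> ext_vanish A B -> retract A Y.
Proof. by move=> jp /(ext_lift idfun jp)[s sE]; exists s, p. Qed.

Lemma ext_split_sub A B Y (j : {linear B -> Y}) (p : {linear Y -> A}) :
  ses j p -> ext_vanish A B -> retract B Y.
Proof. by move=> jp /(_ _ _ _ _ jp idfun)[r rE]; exists j, r. Qed.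

(** Both sides compute Ext^2(A, B).  A map [K -> B] is first extended to [I], and
    the obstruction to its taking values in [B] is a map [K -> B'], which
    extends to [P] and lifts to a map [P -> I]. *)
Lemma ext_shift_quotient B I B' A (j : {linear B -> I}) (q : {linear I -> B'})
    K P (i : {linear K -> P}) (p : {linear P -> A}) :
  injective_module I -> ses j q -> projective P -> ses i p ->
  ext_vanish A B' -> ext_vanish K B.
Proof.
move=> injI jq projP ip eAB' X Y k t kt f.
have [_ tS ktE] := kt; have [jI qS jqE] := jq; have [kI _ _] := kt.
have [g gE] := injI _ _ k (j \o f) kI.
have [|u uE] := @factor_epi _ _ _ _ t (q \o g) tS.
  by move=> y /ktE[x <-] /=; rewrite gE /= (ses_comp0 jq).
have [v vE] := eAB' _ _ _ _ ip u.
have [h hE] := projP _ _ q v qS.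
have [|w wE] := @factor_mono _ _ _ _ j (g \- (h \o i \o t)) jI.
  by move=> y; apply/jqE; rewrite linearB /= hE vE uE /= subrr.
by exists w => x; apply: jI; rewrite wE /= gE (ses_comp0 kt) !linear0 addr0.
Qed.

(** Ext^1(K, F) = Ext^(m+1)(A, F): iterate [ext_shift_quotient] along an injective
    resolution of [F]. *)
Lemma syzygy_ext m A K F : inj_dim_le m F -> syzygy A m K -> ext_vanish K F.
Proof.
elim: m K F => [|m IH] K F; first by move=> injF _; apply: ext_injective.
move=> [I [N [j [p [injI jp idN]]]]]; move mE: m.+1 => m' sK.
case: sK mE => // k K' P L i q sK' projP iq [km]; rewrite -{k}km in sK'.
exact: ext_shift_quotient injI jp projP iq (IH _ _ idN sK').
Qed.

Lemma syzygy_exists A k : exists K, syzygy A k K.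
Proof.
elim: k => [|k [K sK]]; first by exists A; constructor.
have [p pS] := free_cover K; have [L [j jp]] := ses_kernel pS.
by exists L; apply: (syzygyS sK _ jp); apply: fsup_projective.
Qed.

Lemma zero_ses M : exists Z (p : {linear M -> Z}),
  [/\ ses idfun p & forall z : Z, z = 0].
Proof.
have [C [p jp]] := @ses_cokernel M M idfun (fun x y e => e).
exists C, p; split=> // z; have [_ pS pE] := jp; have [x <-] := pS z.
by apply/pE; exists x.
Qed.

Lemma inj_dim_leS k M : inj_dim_le k M -> inj_dim_le k.+1 M.
Proof.
elim: k M => [|k IH] M; last first.
  by move=> [I [N [j [p [injI jp /IH idN]]]]]; exists I, N, j, p.
move=> injM; have [Z [p [jp Z0]]] := zero_ses M.
exists M, Z, idfun, p; split=> // A B i f _.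
by exists (\0 : {linear B -> Z}) => x; apply/esym/Z0.
Qed.

Lemma inj_dim_le_mono k m M : (k <= m)%N -> inj_dim_le k M -> inj_dim_le m M.
Proof.
elim: m => [|m IH]; first by rewrite leqn0 => /eqP ->.
rewrite leq_eqVlt => /orP[/eqP -> //|/IH km] /km; exact: inj_dim_leS.
Qed.

End Homological.

(** * Baer's criterion and divisible groups *)

Section Baer.
Variable R : pzRingType.
Implicit Types M N I : lmodType R.

(** Maps from a left ideal are given as functions on [R] that are linear on
    [J], whose values outside [J] are arbitrary. *)
Definition baer I :=
  forall (J : R -> Prop) (g : R -> I), submodule (M := R^o) J ->
    (forall a r s : R, J r -> J s -> g (a * r + s) = a *: g r + g s) ->
    exists u, forall r : R, J r -> g r = r *: u.

Lemma injective_baer I : injective_module I -> baer I.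
Proof.
move=> injI J g sJ gP; have [K [i [iI iE]]] := submodule_module sJ.
have lg : linear (g \o i).
  by move=> a x y /=; rewrite linearP gP //; apply/iE; [exists x|exists y].
have [h hE] := injI _ _ i (mklin lg) iI.
exists (h 1) => r /iE[k <-]; rewrite -[LHS]/(mklin lg k) -hE -linearZ /=.
by congr (h _); rewrite [RHS]mulr1.
Qed.

Section Extension.
Variables (M N I : lmodType R) (j : {linear M -> N}) (f : {linear M -> I}).
Hypotheses (jI : injective j) (bI : baer I).

(** The graphs of the linear maps that are defined on a submodule of [N] and
    extend [f] along [j]; union of graphs replaces gluing of maps. *)
Definition extension_graph (A : classical_sets.set (N * I)) :=
  [/\ forall x, A (j x, f x),
      forall r y i z k, A (y, i) -> A (z, k) -> A (r *: y + z, r *: i + k)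
    & forall i, A (0, i) -> i = 0].

Lemma extension_graph_sub A y i k : extension_graph A -> A (y, i) -> A (y, k) -> i = k.
Proof.
move=> [_ lA A0] yi yk; apply/eqP; rewrite -subr_eq0; apply/eqP/A0.
by have := lA (-1) _ _ _ _ yk yi; rewrite !scaleN1r addNr addrC.
Qed.

Lemma base_extension_graph :
  extension_graph (fun p => exists x, p = (j x, f x)).
Proof.
split=> [x|r y i z k [a [-> ->]] [b [-> ->]]|i [x [/esym j0 ->]]].
- by exists x.
- by exists (r *: a + b); rewrite !linearP.
- by rewrite (_ : x = 0) ?linear0 //; apply: jI; rewrite linear0.
Qed.

Import classical_sets.
Local Open Scope classical_set_scope.

(** The union of the empty chain is empty, so Zorn's lemma is applied to the
    graphs together with the empty set. *)
Lemma maximal_extension : exists2 A, extension_graph A &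
  forall B, A `<` B -> ~ extension_graph B.
Proof.
have [|A [PA maxA]] := @Zorn_bigcup (N * I) [set A | A = set0 \/ extension_graph A].
  move=> F FP Ftot; case: (pselect (exists2 A, F A & A !=set0)) => [[A0 FA0 A0n]|nF].
    right.
    have gF A : F A -> A !=set0 -> extension_graph A.
      by move=> /FP[->|//] [x []].
    split=> [x|r y i z k [A FA Ayi] [B FB Bzk]|i [A FA A0i]].
    - by exists A0 => //; have [] := gF _ FA0 A0n.
    - have [AB|BA] := Ftot _ _ FA FB.
        exists B => //; have [_ lB _] := gF _ FB (ex_intro _ _ Bzk).
        by apply: lB => //; apply: AB.
      exists A => //; have [_ lA _] := gF _ FA (ex_intro _ _ Ayi).
      by apply: lA => //; apply: BA.
    - by have [_ _] := gF _ FA (ex_intro _ _ A0i); apply.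
  left; rewrite -subset0 => x [A FA Ax]; apply: nF; exists A => //.
  by exists x.
exists A => [|B AB gB]; last by apply: (maxA B AB); right.
case: PA => // A0; case: (maxA _ _ (or_intror base_extension_graph)).
rewrite A0 properEneq; split=> //; apply/eqP => e.
by have : set0 (j 0, f 0) by rewrite e; exists 0.
Qed.

Lemma baer_extend : exists h : {linear N -> I}, forall x, h (j x) = f x.
Proof.
have [A gA maxA] := maximal_extension; have [Af lA A0] := gA.
have A00 : A (0, 0) by have := Af 0; rewrite !linear0.
suff /choice[h hE] y : exists i, A (y, i).
  have lh : linear h.
    by move=> r x y; apply: (extension_graph_sub gA (hE _)); apply: lA.
  by exists (mklin lh) => x; apply: (extension_graph_sub gA (hE _)).
apply: contrapT => ny.
(* If y is not in the domain of A, then r |-> A(r y) is defined on a left ideal,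
   hence is r |-> r u for some u, and sending y to u extends A. *)
pose J (r : R^o) := exists i, A ((r : R) *: y, i).
have sJ : submodule J.
  split=> [|r s [i ri] [k sk]|a r [i ri]]; first by exists 0; rewrite scale0r.
    by exists (1 *: i + k); rewrite -[r]mul1r scalerDl -scalerA; apply: lA.
  by exists (a *: i + 0); rewrite -scalerA -[X in A (X, _)]addr0; apply: lA.
have /choice[g gE] (r : R) : exists i, J r -> A (r *: y, i).
  have [[i ri]|nJ] := pselect (J r); first by exists i.
  by exists 0 => /nJ.
have [//|a r s Jr Js|u uE] := bI (J := J) (g := g).
  apply: (@extension_graph_sub A ((a * r + s) *: y)) => //.
    have [_ SD SZ] := sJ.
    by apply: gE; apply: SD => //; apply: (SZ a).
  by rewrite scalerDl -scalerA; apply: lA; apply: gE.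
pose B (p : N * I) := exists r d, A d /\ p = (d.1 + r *: y, d.2 + r *: u).
apply: (maxA B).
  split=> [[d e] de|BA]; first by exists 0, (d, e); rewrite /= !scale0r !addr0.
  apply: ny; exists u; apply: BA; exists 1, (0, 0); split=> //=.
  by rewrite !scale1r !add0r.
split=> [x|r z i w k [a [[d1 d2] /= [dA [-> ->]]]] [b [[e1 e2] /= [eA [-> ->]]]]|i].
- by exists 0, (j x, f x); rewrite /= !scale0r !addr0.
- exists (r * a + b), (r *: d1 + e1, r *: d2 + e2); split; first exact: lA.
  by rewrite /= !scalerDr !scalerDl !scalerA; congr pair; rewrite addrACA.
move=> [r [[d1 d2] /= [dA [/esym d0 ->]]]]; apply: A0.
have ry : A (r *: y, r *: u).
  rewrite -uE; last first.
    exists (- d2); have := lA (-1) _ _ _ _ dA A00; rewrite !scaleN1r !addr0.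
    by rewrite (_ : - d1 = r *: y) //; apply/eqP; rewrite eq_sym -addr_eq0 addrC d0.
  apply: gE; exists (- d2); have := lA (-1) _ _ _ _ dA A00; rewrite !scaleN1r !addr0.
  by rewrite (_ : - d1 = r *: y) //; apply/eqP; rewrite eq_sym -addr_eq0 addrC d0.
by have := lA 1 _ _ _ _ dA ry; rewrite !scale1r d0.
Qed.
End Extension.

Lemma baer_injective I : baer I -> injective_module I.
Proof. by move=> bI M N j f jI; apply: baer_extend. Qed.

End Baer.

Section Divisible.

Definition divisible (D : lmodType int) :=
  forall (n : int) (d : D), n != 0 -> exists e, n *: e = d.

(** An ideal of the integers is generated by its least positive element [n], and
    dividing the image of [n] by [n] solves Baer's problem. *)
Lemma divisible_injective D : divisible D -> injective_module D.
Proof.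
move=> divD; apply: baer_injective => J g [J0 JD JZ] gP.
have g0 : g 0 = 0.
  have := gP 1 0 0 J0 J0; rewrite mulr0 addr0 scale1r => /eqP.
  by rewrite -subr_eq0 opprD addNKr oppr_eq0 => /eqP.
have gZ a r : J r -> g (a * r) = a *: g r.
  by move=> Jr; have := gP a r 0 Jr J0; rewrite addr0 g0 addr0.
have [ex|nex] := pselect (exists n : nat, (0 < n)%N && `[< J n%:Z >]); last first.
  exists 0 => r Jr; rewrite scaler0; have [-> //|r0] := eqVneq r 0.
  case: nex; exists `|r|%N; rewrite absz_gt0 r0; apply/asboolP.
  by rewrite abszEsg; apply: JZ.
have [n /andP[n0 /asboolP Jn] minn] := ex_minnP ex.
have nZ0 : n%:Z != 0 by rewrite -lt0n.
have [u uE] := divD n (g n) nZ0.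
exists u => r Jr; have Jm : J (r %% n)%Z.
  rewrite /modz; have -> : r - (r %/ n)%Z * n = r + - (r %/ n)%Z * n by rewrite mulNr.
  by apply: JD => //; apply: JZ.
have rn : (r %% n)%Z = 0.
  apply: contrapT => /eqP m0; have m_ge0 := modz_ge0 r nZ0.
  have := minn `|(r %% n)%Z|%N; rewrite absz_gt0 m0 gez0_abs //= asboolT // => /(_ isT).
  by rewrite leqNgt -ltz_nat gez0_abs // ltz_pmod // ltz_nat.
by rewrite {1}(divz_eq r n) rn addr0 gZ // -uE scalerA {2}(divz_eq r n) rn addr0.
Qed.

(** [G] is a quotient of a free abelian group Z^(G) by a subgroup [S], and embeds
    in the divisible group Q^(G) / S. *)
Lemma divisible_hull (G : lmodType int) :
  exists (D : lmodType int) (i : {linear G -> D}), injective i /\ injective_module D.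
Proof.
pose Q : lmodType int := zmodule rat.
pose Z : lmodType int := int^o.
have lg (m : G) : linear (fun r : Z => (r : int) *: m).
  by move=> b r s; rewrite scalerDl scalerA.
have [ev evE] := fsup_lift (fun m => mklin (lg m)).
have linc : linear (fun n : Z => (n : int)%:~R : Q).
  move=> a x y; rewrite rmorphD; congr (_ + _).
  by transitivity ((x : int)%:~R *~ a : rat); rewrite // -mulrzr mulrC -rmorphM.
have [inc incE] := fsup_map G (mklin linc).
have incI : injective inc.
  move=> v w /(congr1 (@fsup_fun _ _ _)) vw; apply: fsup_ext => x.
  have := congr1 (@^~ x) vw; rewrite !incE !mklinE /=.
  exact: (@intr_inj rat).
have inc1 g : inc (single (M := Z) g 1) = single (M := Q) g 1.
  by apply: fsup_ext => x; rewrite incE !singleE mklinE; case: eqP.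
have sS : submodule (fun v => exists2 w, ev w = 0 & inc w = v).
  split=> [|v v' [w w0 <-] [w' w'0 <-]|r v [w w0 <-]].
  - by exists 0; rewrite linear0.
  - by exists (w + w'); rewrite linearD ?w0 ?w'0 ?addr0.
  - by exists (r *: w); rewrite linearZ ?w0 /= ?scaler0.
have [D [p [pS pE]]] := quotient_module sS.
have li : linear (fun g => p (single (M := Q) g 1)).
  move=> a g h; apply/eqP; rewrite -subr_eq0 -linearP -linearB; apply/eqP/pE.
  exists (single (M := Z) (a *: g + h) 1 -
          (a *: single (M := Z) g 1 + single (M := Z) h 1)).
    by rewrite linearB linearP !evE !mklinE !scale1r subrr.
  by rewrite linearB linearP !inc1.
exists D, (mklin li); split.
  apply: inj0P => g /pE[w w0]; rewrite -inc1 => /incI wE.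
  by move: w0; rewrite wE evE mklinE scale1r.
apply: divisible_injective => n d n0; have [v <-] := pS d.
have lm : linear (fun q : Q => (q : rat) / n%:~R : Q).
  move=> a x y; rewrite mulrDl; congr (_ + _).
  by transitivity ((x : rat) *~ a / n%:~R); rewrite // mulrzAl.
have [m mE] := fsup_map G (mklin lm).
exists (p (m v)); rewrite -linearZ; congr (p _); apply: fsup_ext => x.
rewrite fsupZ mE mklinE -[LHS]/(_ *~ n) -mulrzr mulfVK // intr_eq0 //.
Qed.

End Divisible.

(** * Groups of additive maps and enough injective modules *)

Definition additive_map (F : zmodType) (D : lmodType int) (phi : F -> D) :=
  forall x y, phi (x + y) = phi x + phi y.

(** [H] is the group of additive maps from [F] to [D], through the evaluation
    [ev], and [R] operates on it through [act] on [F]. *)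
Definition is_hom_module (R : pzRingType) (F : zmodType) (D : lmodType int)
    (act : R -> F -> F) (H : lmodType R) (ev : H -> F -> D) :=
  [/\ forall h, additive_map (ev h),
      forall h h' x, ev (h + h') x = ev h x + ev h' x,
      forall r h x, ev (r *: h) x = ev h (act r x),
      forall h h', ev h =1 ev h' -> h = h'
    & forall phi, additive_map phi -> exists h, ev h =1 phi].

Section HomModule.
Variables (R : pzRingType) (F : zmodType) (D : lmodType int).
Variable act : R -> F -> F.
Hypotheses (actDr : forall r x y, act r (x + y) = act r x + act r y)
  (actDl : forall r s x, act (r + s) x = act r x + act s x)
  (act1 : forall x, act 1 x = x)
  (actM : forall r s x, act (r * s) x = act s (act r x)).

Lemma additive_submodule : submodule (@additive_map F D).
Proof.
split=> [x y|f g fA gA x y|r f fA x y]; first by rewrite -[LHS]addr0.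
  by rewrite -[LHS]/(f _ + g _) fA gA addrACA.
by rewrite -[LHS]/(r *: f _) fA scalerDr.
Qed.

Definition hom_module : Type := submod additive_submodule.
HB.instance Definition _ := GRing.Zmodule.on hom_module.

Definition hom_ev (h : hom_module) : F -> D := submod_val h.

Lemma hom_evD h x y : hom_ev h (x + y) = hom_ev h x + hom_ev h y.
Proof. by case: h => h hP; have /asboolP := hP; apply. Qed.

Lemma hom_ext h h' : hom_ev h =1 hom_ev h' -> h = h'.
Proof. by move=> e; apply: val_inj; apply/funext. Qed.

Lemma hom_mk phi : additive_map phi -> exists h, hom_ev h =1 phi.
Proof.
move=> phiA; have fP : phi \in submod_pred additive_submodule by apply/asboolP.
by exists (Submod fP).
Qed.

Lemma hom_addE h h' x : hom_ev (h + h') x = hom_ev h x + hom_ev h' x.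
Proof. by []. Qed.

Lemma act_additive r h : additive_map (hom_ev h \o act r).
Proof. by move=> x y /=; rewrite actDr hom_evD. Qed.

Definition hom_scale r h : hom_module := projT1 (cid (hom_mk (act_additive r h))).

Lemma hom_scaleE r h x : hom_ev (hom_scale r h) x = hom_ev h (act r x).
Proof. by rewrite /hom_scale; case: cid. Qed.

Lemma hom_scaleA a b h : hom_scale a (hom_scale b h) = hom_scale (a * b) h.
Proof. by apply: hom_ext => x; rewrite !hom_scaleE actM. Qed.
Lemma hom_scale1 : left_id 1 hom_scale.
Proof. by move=> h; apply: hom_ext => x; rewrite hom_scaleE act1. Qed.
Lemma hom_scaleDr : right_distributive hom_scale +%R.
Proof. by move=> a h k; apply: hom_ext => x; rewrite !(hom_scaleE, hom_addE). Qed.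
Lemma hom_scaleDl h : {morph hom_scale^~ h : a b / a + b}.
Proof.
move=> a b; apply: hom_ext => x.
by rewrite !(hom_scaleE, hom_addE, actDl) hom_evD.
Qed.

HB.instance Definition _ := GRing.Zmodule_isLmodule.Build R hom_module
  hom_scaleA hom_scale1 hom_scaleDr hom_scaleDl.

(** The group of additive maps on which [R] operates by precomposition with a
    right action on [F].  The action is a mere function so that [F] can be the
    ring acting on itself as well as a left module seen over the converse
    ring. *)
Lemma hom_module_exists :
  exists (H : lmodType R) (ev : H -> F -> D), is_hom_module act ev.
Proof.
exists (hom_module : lmodType R), hom_ev; split.
- exact: hom_evD.
- exact: hom_addE.
- exact: hom_scaleE.
- exact: hom_ext.
- exact: hom_mk.
Qed.

End HomModule.

Lemma additive_linear (U V : lmodType int) (f : U -> V) :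
  (forall x y, f (x + y) = f x + f y) -> linear f.
Proof.
move=> fD; have f0 : f 0 = 0 by apply: (addrI (f 0)); rewrite -fD !addr0.
have fN x : f (- x) = - f x by apply: (addrI (f x)); rewrite -fD !subrr.
have fn (n : nat) x : f (n%:Z *: x) = n%:Z *: f x.
  elim: n => [|n IH]; first by rewrite !scale0r.
  by rewrite -addn1 PoszD !scalerDl !scale1r fD IH.
move=> a x y; rewrite fD; congr (_ + _); case: a => n; first exact: fn.
by rewrite NegzE !scaleNr fN fn.
Qed.

(** For an embedding of [M] in a divisible group [D], sending [x] to the map
    [r |-> r x] embeds [M] in Hom_Z(R, D).  Linear maps to Hom_Z(R, D) are the same
    as additive maps to [D], so the injectivity of [D] passes to it. *)
Lemma enough_injectives (R : pzRingType) (M : lmodType R) :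
  exists (I : lmodType R) (j : {linear M -> I}), injective j /\ injective_module I.
Proof.
have [D [i [iI injD]]] := divisible_hull (zmodule M : lmodType int).
have [||||H [ev [evD evA evZ evX evM]]] := @hom_module_exists R R D (fun r x => x * r).
- by move=> r x y; rewrite mulrDl.
- by move=> r s x; rewrite mulrDr.
- by move=> x; rewrite mulr1.
- by move=> r s x; rewrite mulrA.
have lift (N : lmodType R) (phi : N -> D) : (forall x y, phi (x + y) = phi x + phi y) ->
    exists h : {linear N -> H}, forall x r, ev (h x) r = phi (r *: x).
  move=> phiD; have /choice[h hE] x : exists k, ev k =1 (fun r => phi (r *: x)).
    by apply: evM => r s; rewrite scalerDl phiD.
  have lh : linear h.
    move=> a x y; apply: evX => r; rewrite evA evZ !hE -phiD scalerDr scalerA //.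
  by exists (mklin lh).
have [//|j jE] := lift M i; first exact: (linearD i).
exists H, j; split.
  move=> x y xy; apply: iI; have := jE x 1; rewrite xy jE !scale1r //.
move=> A B k f kI.
have lk : linear (k : zmodule A -> zmodule B).
  by apply: additive_linear => x y; apply: linearD.
have lf : linear (fun x : zmodule A => ev (f x) 1).
  by apply: additive_linear => x y; rewrite (linearD f x y) evA.
have [g gE] := injD _ _ (mklin lk) (mklin lf) kI.
have [//|h hE] := lift B g; first exact: (linearD g).
exists h => x; apply: evX => r; rewrite hE -linearZ.
transitivity (mklin lf (r *: x)); first exact: gE.
by rewrite mklinE linearZ evZ mul1r.
Qed.

(** * Noetherian rings *)

Section Noetherian.
Variable R : pzRingType.
Implicit Types M X Y Z C I K N : lmodType R.

Fixpoint in_span M (s : seq M) (x : M) : Prop :=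
  if s is a :: s' then exists (r : R) y, in_span s' y /\ x = r *: a + y else x = 0.

Lemma in_span_submodule M (s : seq M) : submodule (in_span s).
Proof.
elim: s => [|a s [S0 SD SZ]].
  by split=> [//|x y -> ->|r x ->]; rewrite ?addr0 ?scaler0.
split=> [|x y [r [z [sz ->]]] [t [w [sw ->]]]|t x [r [z [sz ->]]]].
- by exists 0, 0; rewrite scale0r addr0.
- by exists (r + t), (z + w); split; [exact: SD|rewrite scalerDl addrACA].
- by exists (t * r), (t *: z); split; [exact: SZ|rewrite scalerDr scalerA].
Qed.

Lemma in_span_head M (a : M) s : in_span (a :: s) a.
Proof. by have [S0 _ _] := in_span_submodule s; exists 1, 0; rewrite scale1r addr0. Qed.

Lemma in_span_cons M (a : M) s x : in_span s x -> in_span (a :: s) x.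
Proof. by move=> sx; exists 0, x; rewrite scale0r add0r. Qed.

Lemma in_span_sum M (s : seq M) x : in_span s x ->
  exists c : 'I_(size s) -> R, x = \sum_i c i *: nth 0 s i.
Proof.
elim: s x => [|a s IH] x /=; first by move->; exists (fun=> 0); rewrite big_ord0.
move=> [r [y [/IH[c ->] ->]]].
exists (fun i => if unlift ord0 i is Some k then c k else r).
rewrite big_ord_recl unlift_none /=; congr (_ + _); apply: eq_bigr => i _.
by rewrite liftK /=.
Qed.

(** Otherwise one can add forever to a finite sequence of elements of [S] one more
    element outside their span, which contradicts the ascending chain
    condition. *)
Lemma noetherian_fg M (S : M -> Prop) : noetherian_module M -> submodule S ->
  exists k (s : 'I_k -> M), (forall i, S (s i)) /\
    forall x, S x -> exists c : 'I_k -> R, x = \sum_i c i *: s i.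
Proof.
move=> noeM sS; suff [s sS' Ss] : exists2 s : seq M, (forall x, x \in s -> S x) &
    forall x, S x -> in_span s x.
  exists (size s), (fun i => nth 0 s i); split=> [i|x /Ss/in_span_sum//].
  by apply: sS'; apply: mem_nth.
apply: contrapT => nfg.
have /choice[nxt nxtP] (s : seq M) :
    exists x, (forall y, y \in s -> S y) -> S x /\ ~ in_span s x.
  have [sS'|nsS] := pselect (forall y, y \in s -> S y); last by exists 0 => /nsS.
  apply: contrapT => nx; apply: nfg; exists s => // x Sx.
  by apply: contrapT => nsx; apply: nx; exists x.
pose T n := iter n (fun s => nxt s :: s) [::].
have TS n : forall y, y \in T n -> S y.
  elim: n => [|n IH] y //=; rewrite inE => /orP[/eqP ->|/IH //].
  by case: (nxtP _ IH).
have [m mP] := noeM (fun n => in_span (T n)) (fun n => in_span_submodule _)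
  (fun n x => @in_span_cons _ _ _ x).
have [_ []] := nxtP _ (TS m).
by apply: (mP m.+1) => //; apply: in_span_head.
Qed.

Lemma chain_mono M (S : nat -> M -> Prop) : (forall i x, S i x -> S i.+1 x) ->
  forall i k x, (i <= k)%N -> S i x -> S k x.
Proof.
move=> Sm i k x; elim: k => [|k IH]; first by rewrite leqn0 => /eqP ->.
by rewrite leq_eqVlt => /orP[/eqP -> //|/IH ik] /ik/Sm.
Qed.

Lemma noetherian_ses X Y Z (j : {linear X -> Y}) (p : {linear Y -> Z}) : ses j p ->
  noetherian_module X -> noetherian_module Z -> noetherian_module Y.
Proof.
move=> [jI pS jpE] nX nZ S sS Sm.
have [i|i x|m1 m1P] := nX (fun i x => S i (j x)); [|exact: Sm|].
- have [S0 SD SZ] := sS i.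
  split=> [|x y|r x]; rewrite ?linear0 ?linearD ?linearZ //; [exact: SD|exact: SZ].
have [i|i x [y [Sy py]]|m2 m2P] := nZ (fun i z => exists y, S i y /\ p y = z).
- have [S0 SD SZ] := sS i; split=> [|x y [x' [Sx <-]] [y' [Sy <-]]|r x [x' [Sx <-]]].
  + by exists 0; rewrite linear0.
  + by exists (x' + y'); rewrite linearD; split=> //; apply: SD.
  + by exists (r *: x'); rewrite linearZ; split=> //; apply: SZ.
- by exists y; split=> //; apply: Sm.
exists (maxn m1 m2) => i y; rewrite geq_max => /andP[im1 im2] Sy.
have [|y' [Sy' py']] := m2P i (p y) im2; first by exists y.
have /jpE[x jx] : p (y - y') = 0 by rewrite linearB py' subrr.
have [_ SD SZ] := sS (maxn m1 m2); have [_ SDi SZi] := sS i.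
have -> : y = y' + j x by rewrite jx addrC subrK.
apply: SD; first exact: (chain_mono Sm (leq_maxr m1 m2)).
apply: (chain_mono Sm (leq_maxl m1 m2)); apply: (m1P i) => //.
rewrite jx; apply: SDi => //; rewrite -scaleN1r; apply: SZi.
exact: (chain_mono Sm im2).
Qed.

Lemma rV_lift M k (m : 'I_k -> M) :
  exists h : {linear 'rV[R]_k -> M}, forall v, h v = \sum_i v 0 i *: m i.
Proof.
have lh : linear (fun v : 'rV[R]_k => \sum_i v 0 i *: m i).
  move=> a v w; rewrite scaler_sumr -big_split; apply: eq_bigr => i _.
  by rewrite !mxE scalerDl scalerA.
by exists (mklin lh).
Qed.

Lemma rV_linE M k (f : {linear 'rV[R]_k -> M}) v :
  f v = \sum_i v 0 i *: f (delta_mx 0 i).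
Proof.
rewrite {1}(row_sum_delta v) linear_sum; apply: eq_bigr => i _.
by rewrite linearZ.
Qed.

Lemma sum_delta M k (m : 'I_k -> M) (i : 'I_k) :
  \sum_a (delta_mx 0 i : 'rV[R]_k) 0 a *: m a = m i.
Proof.
rewrite (bigD1 i) //= mxE !eqxx scale1r big1 ?addr0 // => a ai.
by rewrite mxE (negbTE ai) scale0r.
Qed.

Lemma rV_projective k : projective ('rV[R]_k : lmodType R).
Proof.
move=> A B p f pS; have [a aE] := choice (fun i => pS (f (delta_mx 0 i))).
have [h hE] := rV_lift a; exists h => v.
rewrite hE linear_sum (rV_linE f); apply: eq_bigr => i _.
by rewrite linearZ /= aE.
Qed.

Lemma rV_noetherian k : left_noetherian R -> noetherian_module ('rV[R]_k : lmodType R).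
Proof.
move=> noeR; elim: k => [|k IH].
  move=> S sS Sm; exists 0%N => i x _ _; rewrite (thinmx0 x).
  by have [] := sS 0%N.
have lp : linear (fun v : 'rV[R]_(1 + k) => v 0 (lshift k 0) : R^o).
  by move=> a v w; rewrite !mxE.
have lj : linear (fun v : 'rV[R]_k => row_mx 0 v : 'rV[R]_(1 + k)).
  by move=> a v w; rewrite scale_row_mx add_row_mx scaler0 addr0.
apply: (noetherian_ses (j := mklin lj) (p := mklin lp)) => //.
split=> [v w|r|v].
- by rewrite !mklinE => /eq_row_mx[].
- exists (row_mx r%:M 0); rewrite mklinE row_mxEl !mxE eqxx mulr1n //.
split=> [|[w <-]]; last by rewrite !mklinE row_mxEl mxE.
rewrite mklinE => v0; exists (rsubmx v); rewrite mklinE -[RHS]hsubmxK; congr row_mx.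
by apply/rowP => i; rewrite !mxE ord1 v0.
Qed.

Lemma fg_step C k (p : {linear 'rV[R]_k -> C}) : left_noetherian R -> surj_map p ->
  exists K (j : {linear K -> 'rV[R]_k}) l (q : {linear 'rV[R]_l -> K}),
    ses j p /\ surj_map q.
Proof.
move=> noeR pS; have [K [j jp]] := ses_kernel pS; have [jI _ jpE] := jp.
have sJ : submodule (fun v => exists u, j u = v).
  split=> [|x y [u <-] [v <-]|r x [u <-]]; first by exists 0; rewrite linear0.
    by exists (u + v); rewrite linearD.
  by exists (r *: u); rewrite linearZ.
have [l [s [/choice[t tE] sP]]] := noetherian_fg (@rV_noetherian k noeR) sJ.
have [q qE] := rV_lift t; exists K, j, l, q; split=> // u.
have [|c cE] := sP (j u); first by exists u.
exists (\row_i c i); apply: jI; rewrite cE qE linear_sum; apply: eq_bigr => i _.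
by rewrite linearZ /= tE mxE.
Qed.

Lemma ideal_map0 (J : R -> Prop) M (g : R -> M) : submodule (M := R^o) J ->
  (forall a r s : R, J r -> J s -> g (a * r + s) = a *: g r + g s) -> g 0 = 0.
Proof.
move=> [J0 _ _] gP; have := gP 1 0 0 J0 J0; rewrite mulr0 addr0 scale1r => /eqP.
by rewrite -subr_eq0 opprD addNKr oppr_eq0 => /eqP.
Qed.

Lemma ideal_map_sum (J : R -> Prop) M (g : R -> M) k (c s : 'I_k -> R) :
  submodule (M := R^o) J ->
  (forall a r s : R, J r -> J s -> g (a * r + s) = a *: g r + g s) ->
  (forall i, J (s i)) ->
  g (\sum_i c i * s i) = \sum_i c i *: g (s i).
Proof.
move=> sJ gP Js; have [J0 JD JZ] := sJ.
suff [] : J (\sum_i c i * s i) /\ g (\sum_i c i * s i) = \sum_i c i *: g (s i) by [].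
elim/big_rec2: _ => [|i x y _ [Jy gy]]; first by rewrite (ideal_map0 sJ gP).
by rewrite gP // gy; split=> //; apply: JD => //; apply: JZ.
Qed.

(** A map from a finitely generated left ideal to a direct sum takes its values in
    a finite subsum, so Baer's problem can be solved at finitely many indices
    and by 0 at the others. *)
Lemma fsup_injective (X : eqType) M : left_noetherian R -> injective_module M ->
  injective_module (fsup X M).
Proof.
move=> noeR injM; apply: baer_injective => J g sJ gP.
have [k [s [sJ' sP]]] := noetherian_fg noeR sJ.
have /choice[t tP] i : exists t, supported t (fsup_fun (g (s i))).
  by have [t _ tt] := fsup_finite (g (s i)); exists t.
pose T := flatten [seq t i | i : 'I_k].
have gT r : J r -> supported T (fsup_fun (g r)).
  move=> Jr x xT; have xt i : x \notin t i.
    by apply: contra xT => xi; apply/flattenP; exists (t i) => //; apply: image_f.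
  have [c ->] := sP r Jr; rewrite (ideal_map_sum _ sJ gP) // fsup_sum big1 // => i _.
  by rewrite fsupZ tP ?scaler0.
have /choice[u uE] x : exists u, (forall r : R, J r -> fsup_fun (g r) x = r *: u) /\
    (x \notin T -> u = 0).
  have [xT|xT] := boolP (x \in T); last first.
    by exists 0; split=> // r Jr; rewrite gT ?scaler0.
  have [//|a r r' Jr Jr'|u uE] :=
      injective_baer injM (J := J) (g := fun r => fsup_fun (g r) x).
    by rewrite gP // fsupD fsupZ.
  by exists u.
have [|v vE] := @fsup_mk _ _ _ u T; first by move=> x; apply: (uE x).2.
by exists v => r Jr; apply: fsup_ext => x; rewrite fsupZ vE (uE x).1.
Qed.

Lemma fsup_inj_dim (X : eqType) (k : nat) M : left_noetherian R -> inj_dim_le k M ->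
  inj_dim_le k (fsup X M).
Proof.
move=> noeR; elim: k M => [|k IH] M; first exact: fsup_injective.
move=> [I [N [j [p [injI jp /IH idN]]]]].
have [j' [p' jp']] := fsup_ses X jp.
by exists (fsup X I), (fsup X N), j', p'; split=> //; apply: fsup_injective.
Qed.

End Noetherian.

(** * Tor of syzygies, and flatness by additive duality *)

Section Extend.
Variable R : pzRingType.
Implicit Types X Y M I F S Q K C : lmodType R.

(** Injectivity of [I], used for the embedding of the image of [d] in [Y]. *)
Lemma injective_extend X Y I (d : {linear X -> Y}) (f : {linear X -> I}) :
  injective_module I -> (forall x, d x = 0 -> f x = 0) ->
  exists g : {linear Y -> I}, forall x, g (d x) = f x.
Proof.
move=> injI df.
have [K [k [kI kd]]] := kernel_exists d.
have [C [p [pS pk]]] := cokernel_exists k.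
have [|j jE] := @factor_epi _ _ _ _ p d pS.
  by move=> x /pk[u <-]; apply/kd; exists u.
have jI : injective j.
  apply: inj0P => c; have [x <-] := pS c; rewrite jE => /kd ku; exact/pk.
have [|u uE] := @factor_epi _ _ _ _ p f pS.
  by move=> x /pk[v <-]; apply: df; apply/kd; exists v.
have [g gE] := injI _ _ j u jI.
by exists g => x; rewrite -jE gE uE.
Qed.

(** Exactness of Hom(-, F) at [Q1], for [S2 -> Q1 -> Q0] with [S1] the image of
    [Q1] in [Q0]: a map that kills [S2] is a map on [S1], and the
    obstruction to its extension to [Q0] is in Ext^1(S0, F). *)
Lemma hom_exact S2 Q1 S1 Q0 S0 F (j1 : {linear S2 -> Q1}) (p1 : {linear Q1 -> S1})
    (j0 : {linear S1 -> Q0}) (p0 : {linear Q0 -> S0}) (f : {linear Q1 -> F}) :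
  ses j1 p1 -> ses j0 p0 -> ext_vanish S0 F -> (forall x, f (j1 x) = 0) ->
  exists g : {linear Q0 -> F}, forall x, g (j0 (p1 x)) = f x.
Proof.
move=> [_ p1S jp1] jp0 eF f0.
have [|u uE] := @factor_epi _ _ _ _ p1 f p1S; first by move=> x /jp1[y <-].
have [g gE] := eF _ _ j0 p0 jp0 u.
by exists g => x; rewrite gE uE.
Qed.
End Extend.

Section Tens.
Variable R : pzRingType.

(** The map that [f : R^l -> R^m] induces after tensoring with [F], when R^l tensor F
    is identified with F^l. *)
Definition tens (F : lmodType R) l m (f : {linear 'rV[R^c]_l -> 'rV[R^c]_m})
    (x : 'I_l -> F) : 'I_m -> F :=
  fun a => \sum_b (f (delta_mx 0 b) 0 a : R) *: x b.

Implicit Types F P A K I : lmodType R.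

Lemma tens_comp F l m k (f : {linear 'rV[R^c]_m -> 'rV[R^c]_k})
    (g : {linear 'rV[R^c]_l -> 'rV[R^c]_m}) (x : 'I_l -> F) a :
  tens f (tens g x) a = tens (f \o g) x a.
Proof.
rewrite /tens; under eq_bigr do rewrite scaler_sumr; rewrite exchange_big.
apply: eq_bigr => c _ /=; rewrite (rV_linE f) summxE scaler_suml.
by apply: eq_bigr => b _; rewrite scalerA mxE.
Qed.

Lemma tens_lin F A l m (f : {linear 'rV[R^c]_l -> 'rV[R^c]_m}) (phi : {linear F -> A})
    (x : 'I_l -> F) a :
  phi (tens f x a) = tens f (phi \o x) a.
Proof. by rewrite linear_sum; apply: eq_bigr => b _; rewrite linearZ. Qed.

Lemma tensB F l m (f : {linear 'rV[R^c]_l -> 'rV[R^c]_m}) (x y : 'I_l -> F) a :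
  tens f (fun b => x b - y b) a = tens f x a - tens f y a.
Proof. by rewrite /tens -sumrB; apply: eq_bigr => b _; rewrite scalerBr. Qed.

Lemma eq_tens F l m (f : {linear 'rV[R^c]_l -> 'rV[R^c]_m}) (x y : 'I_l -> F) :
  x =1 y -> tens f x =1 tens f y.
Proof. by move=> xy a; apply: eq_bigr => b _; rewrite xy. Qed.

Lemma tens_eq0 F l m (f : {linear 'rV[R^c]_l -> 'rV[R^c]_m}) (x : 'I_l -> F) a :
  (forall v, f v = 0) -> tens f x a = 0.
Proof. by move=> f0; rewrite /tens big1 // => b _; rewrite f0 mxE scale0r. Qed.

(* A resolution of the right module [S 0] by free modules of finite rank, cut
    into short exact sequences [S i.+1 -> R^(k i) -> S i]. *)
Variables (k : nat -> nat) (S : nat -> lmodType R^c).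
Variables (j : forall i, {linear S i.+1 -> 'rV[R^c]_(k i)}).
Variables (p : forall i, {linear 'rV[R^c]_(k i) -> S i}).
Hypothesis jp : forall i, ses (j i) (p i).

Definition diff i : {linear 'rV[R^c]_(k i.+1) -> 'rV[R^c]_(k i)} := j i \o p i.+1.

Lemma diff_diff i v : diff i (diff i.+1 v) = 0.
Proof. by rewrite /diff /= (ses_comp0 (jp i.+1)) linear0. Qed.

Lemma diff_exact i v : diff i v = 0 -> exists u, diff i.+1 u = v.
Proof.
have [jI _ _] := jp i; have [_ _ jpE] := jp i.+1; have [_ pS _] := jp i.+2.
move=> dv; have /jpE[s <-] : p i.+1 v = 0 by apply: jI; rewrite linear0.
by have [u <-] := pS s; exists u.
Qed.

(** Tor_(i+1)(S 0, F) = 0. *)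
Definition tor_vanish F i :=
  forall x : 'I_(k i.+1) -> F, (forall a, tens (diff i) x a = 0) ->
  exists y, x =1 tens (diff i.+1) y.

Lemma tens_diff_diff F i (y : 'I_(k i.+2) -> F) a :
  tens (diff i) (tens (diff i.+1) y) a = 0.
Proof. by rewrite tens_comp tens_eq0 // => v; apply: diff_diff. Qed.

Lemma tor_vanish_ring (i : nat) (x : 'I_(k i.+1) -> R) :
  (forall a, tens (F := R^o) (diff i) x a = 0) ->
  exists y : 'I_(k i.+2) -> R, forall b, x b = tens (F := R^o) (diff i.+1) y b.
Proof.
move=> x0; pose v : 'rV[R^c]_(k i.+1) := \row_b x b.
have [|u uE] := @diff_exact i v.
  apply/rowP => a; rewrite (rV_linE (diff i)) summxE [RHS]mxE -[RHS](x0 a).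
  by apply: eq_bigr => b _; rewrite !mxE.
exists (fun c => u 0 c) => b; have -> : x b = v 0 b by rewrite mxE.
rewrite -uE (rV_linE (diff i.+1)) summxE; apply: eq_bigr => c _.
by rewrite !mxE.
Qed.

(** A family of elements of a free module is killed if and only if it is so at each
    index, where [tor_vanish_ring] applies; 0 is chosen outside the finite union
    [T] of the supports. *)
Lemma tor_vanish_free (X : eqType) i : tor_vanish (fsup X (R^o : lmodType R)) i.
Proof.
move=> x x0; have /choice[s sP] b : exists s, supported s (fsup_fun (x b)).
  by have [s _ ss] := fsup_finite (x b); exists s.
pose T := flatten [seq s b | b : 'I_(k i.+1)].
have xT b t : t \notin T -> fsup_fun (x b) t = 0.
  move=> tT; apply: sP; apply: contra tT => ts; apply/flattenP.
  by exists (s b) => //; apply: image_f.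
have tensE l m (f : {linear 'rV[R^c]_l -> 'rV[R^c]_m})
    (z : 'I_l -> fsup X (R^o : lmodType R)) a t :
    fsup_fun (tens f z a) t = tens (F := R^o) f (fun b => fsup_fun (z b) t) a.
  by rewrite fsup_sum.
have /choice[y yE] t : exists y : 'I_(k i.+2) -> R,
    (forall b, fsup_fun (x b) t = tens (F := R^o) (diff i.+1) y b) /\
    (t \notin T -> forall c, y c = 0).
  have [tT|tT] := boolP (t \in T); last first.
    exists (fun=> 0); split=> // b; rewrite xT // /tens big1 // => c _; exact: mulr0.
  have [|y yE] := @tor_vanish_ring i (fun b => fsup_fun (x b) t); last by exists y.
  by move=> a; rewrite -tensE x0.
have /choice[z zE] c :
    exists z : fsup X (R^o : lmodType R), fsup_fun z =1 (fun t => y t c).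
  by apply: (fsup_mk (s := T)) => t tT; rewrite (yE t).2.
exists z => b; apply: fsup_ext => t; rewrite tensE (yE t).1.
by apply: (eq_tens (F := R^o)) => c; rewrite zE.
Qed.

Lemma tor_vanish_retract F A i : retract F A -> tor_vanish A i -> tor_vanish F i.
Proof.
move=> [u [r ru]] tA x x0; have [|y yE] := tA (u \o x).
  by move=> a; rewrite -tens_lin x0 linear0.
exists (r \o y) => b; rewrite -tens_lin -yE /= ru //.
Qed.

Lemma tor_vanish_projective P i : projective P -> tor_vanish P i.
Proof.
move=> projP; have [q qS] := free_cover P; have [s sE] := projP _ _ q idfun qS.
by apply: tor_vanish_retract; [exists s, q|apply: tor_vanish_free].
Qed.

(** Dimension shift in the second variable: the connecting map from
    Tor_(i+2)(S 0, A) to Tor_(i+1)(S 0, K) is onto. *)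
Lemma tor_vanish_shift K P A (t : {linear K -> P}) (q : {linear P -> A}) i :
  ses t q -> tor_vanish P i -> tor_vanish A i.+1 -> tor_vanish K i.
Proof.
move=> tq tP tA x x0; have [tI qS tqE] := tq.
have [|y yE] := tP (t \o x); first by move=> a; rewrite -tens_lin x0 linear0.
have [|z zE] := tA (q \o y).
  by move=> a; rewrite -tens_lin -yE /= (ses_comp0 tq).
have /choice[w wE] c := qS (z c).
have /choice[y' y'E] c : exists u, t u = y c - tens (diff i.+2) w c.
  apply/tqE; rewrite linearB -[q (y c)]/((q \o y) c) zE tens_lin.
  by rewrite (@eq_tens _ _ _ _ z (q \o w)) ?subrr // => d /=; rewrite wE.
exists y' => b; apply: tI; rewrite tens_lin.
rewrite (@eq_tens _ _ _ _ (t \o y') _ y'E) tensB tens_diff_diff subr0.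
exact: yE.
Qed.

(** Tor_(i+1)(S 0, I) is Hom(Ext^(i+1)(S 0, R), I).  A cycle [x] is the linear map
    [xh : w |-> sum of the w_b x_b] on the dual of the free module, and it is a
    boundary when it factors through the transpose of the differential [E].
    As [I] is injective, it is enough that [xh] vanishes on the kernel of this
    transpose.  The elements of the kernel are the cocycles of Hom(-, R); they
    are coboundaries by the assumption on Ext, and [xh] kills coboundaries
    because [x] is a cycle. *)
Lemma tor_vanish_injective I i : injective_module I ->
  ext_vanish (S i) ((R^c)^o : lmodType R^c) -> tor_vanish I i.
Proof.
move=> injI eS x x0; pose N := k i.+1; pose L := k i.+2.
pose D := diff i; pose E := diff i.+1.
have [xh xhE] := rV_lift x.
have lT : linear (fun w : 'rV[R]_N =>
    \row_c \sum_b w 0 b * (E (delta_mx 0 c) 0 b : R) : 'rV[R]_L).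
  move=> a v w; apply/rowP => c; rewrite !mxE big_distrr -big_split.
  apply: eq_bigr => b _.
  by rewrite !mxE mulrDl -mulrA.
have [|y yE] := @injective_extend _ _ _ _ (mklin lT) xh injI.
  move=> w /rowP Tw; rewrite xhE.
  have [wh whE] := @rV_lift R^c ((R^c)^o) N (fun b => w 0 b).
  have wE v : wh (E v) = 0.
    rewrite (rV_linE E) linear_sum big1 // => c _; rewrite linearZ /= whE.
    have := Tw c; rewrite mklinE !mxE => Tc.
    by rewrite (_ : \sum_b _ = 0) ?scaler0 // -[RHS]Tc; apply: eq_bigr.
  have [|g gE] := hom_exact (f := wh) (jp i.+1) (jp i) eS.
    by move=> s; have [_ pS _] := jp i.+2; have [v <-] := pS s; exact: wE.
  have wbE b : w 0 b = \sum_a (g (delta_mx 0 a) : R) * (D (delta_mx 0 b) 0 a : R).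
    have := gE (delta_mx 0 b); rewrite whE sum_delta => <-.
    by rewrite -[j i _]/(D (delta_mx 0 b)) (rV_linE g).
  under eq_bigr do rewrite wbE scaler_suml; rewrite exchange_big big1 // => a _.
  under eq_bigr do rewrite -scalerA; rewrite -scaler_sumr.
  by rewrite -[X in _ *: X]/(tens D x a) x0 scaler0.
exists (fun c => y (delta_mx 0 c)) => b.
have := yE (delta_mx 0 b); rewrite xhE sum_delta => <-.
rewrite (rV_linE y); apply: eq_bigr => c _; congr (_ *: _).
rewrite mklinE mxE (bigD1 b) //= mxE !eqxx mul1r big1 ?addr0 // => a ab.
by rewrite mxE (negbTE ab) mul0r.
Qed.

Lemma tor_vanish_syzygy I n m K :
  injective_module I ->
  (forall i, (n <= i)%N -> ext_vanish (S i) ((R^c)^o : lmodType R^c)) ->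
  (n <= m)%N -> syzygy I m K -> tor_vanish K 0.
Proof.
move=> injI eS nm sK; suff: forall i, (n <= m + i)%N -> tor_vanish K i.
  by apply; rewrite addn0.
elim: sK {nm} => {m K} [|m K P L t q sK IH projP tq] i.
  by move=> ni; apply: tor_vanish_injective => //; apply: eS.
move=> nmi; apply: (tor_vanish_shift tq); first exact: tor_vanish_projective.
by apply: IH; rewrite addnS.
Qed.

End Tens.

Section Flat.
Variable R : pzRingType.

Lemma tensor_ext (A : lmodType R^c) (F : lmodType R) (D : zmodType)
    (f g : tensor A F -> D) :
  (forall u v, f (u - v) = f u - f v) -> (forall u v, g (u - v) = g u - g v) ->
  (forall a x, f (tmul a x) = g (tmul a x)) -> f =1 g.
Proof.
move=> fB gB fg t; rewrite -[t]reprK; move: (repr _) => z {t}.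
pose q (z : tfree A F) : tensor A F := \pi_(Quotient.quot (@tensor_relb R A F)) z.
have f0 : f 0 = g 0 by rewrite -[0](subrr 0) fB gB !subrr.
have fN u : f u = g u -> f (- u) = g (- u).
  by move=> fu; rewrite -[- u]sub0r fB gB f0 fu.
have fD u v : f u = g u -> f v = g v -> f (u + v) = g (u + v).
  by move=> fu fv; rewrite -[v]opprK fB gB fu fN.
have fM u n : f u = g u -> f (u *+ n) = g (u *+ n).
  by move=> fu; elim: n => [|n IH]; rewrite ?mulr0n // mulrS; apply: fD.
have fq k a x : f (q (freeg.Freeg [:: (k, (a, x))])) =
    g (q (freeg.Freeg [:: (k, (a, x))])).
  have -> : q (freeg.Freeg [:: (k, (a, x))]) = tmul a x *~ k.
    by rewrite /tmul -raddfMz freeg.freegU_mulz intz.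
  case: k => n; first exact: fM.
  by rewrite NegzE mulrNz; apply/fN/fM.
rewrite -(freeg.freeg_sumE z) raddf_sum.
by elim/big_rec: _ => // -[a x] u _ fu; apply: fD => //; apply: fq.
Qed.

(** For [A -> B] injective, embed the tensor product of [A] and [F] in a divisible
    group [D].  The embedding is a linear map from [A] to Hom_Z(F, D).  If the
    latter is injective, this map extends to [B], which says that the embedding
    factors through the tensor product of [B] and [F]. *)
Lemma hom_injective_flat (F : lmodType R) :
  (forall (D : lmodType int) (H : lmodType R^c) (ev : H -> F -> D),
     injective_module D ->
     is_hom_module (fun (r : R^c) x => (r : R) *: x) ev ->
     injective_module H) ->
  flat F.
Proof.
move=> injH A B f fI.
have [D [i [iI injD]]] := divisible_hull (zmodule (tensor A F) : lmodType int).
have [||||H [ev evP]] :=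
    @hom_module_exists R^c F D (fun r x => (r : R) *: x).
- by move=> r x y; rewrite scalerDr.
- by move=> r s x; rewrite scalerDl.
- by move=> x; rewrite scale1r.
- by move=> r s x; rewrite scalerA.
have {}injH : injective_module H := injH D H ev injD evP.
have [evD evA evZ evX evM] := evP.
have /choice[a aE] (x : A) : exists h, ev h =1 (fun y => i (tmul x y)).
  by apply: evM => y z; rewrite tmulDr (linearD i).
have la : linear a.
  move=> r x y; apply: evX => z; rewrite evA evZ !aE tmulDl (linearD i).
  by rewrite -tmulZ.
have [g gE] := injH _ _ f (mklin la) fI.
(* lam : B tensor F -> D is the additive map that corresponds to g. *)
pose gam (t : tfree B F) : D := freeg.fglift (fun q : B * F => ev (g q.1) q.2) t.
have gamB u v : gam (u - v) = gam u - gam v by apply: freeg.lift_is_additive.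
have gamU b x : gam (tgen b x) = ev (g b) x by rewrite /gam freeg.liftU scale1r.
have ev0 h : ev h 0 = 0 by apply: (addrI (ev h 0)); rewrite -evD !addr0.
have gam_rel z : tensor_rel z -> gam z = 0.
  elim=> [b b' x|b x x'|r b x||u v _ u0 _ v0].
  - by rewrite !gamB !gamU linearD evA addrAC addrK subrr.
  - by rewrite !gamB !gamU evD addrAC addrK subrr.
  - by rewrite gamB !gamU linearZ evZ subrr.
  - by rewrite -[0 in LHS]subr0 gamB subrr.
  - by rewrite gamB u0 v0 subrr.
pose lam (t : tensor B F) : D := gam (repr (t : Quotient.quot (@tensor_relb R B F))).
have lam_pi z : lam (\pi_(Quotient.quot (@tensor_relb R B F)) z) = gam z.
  apply/eqP; rewrite -subr_eq0 -gamB; apply/eqP/gam_rel/asboolP.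
  rewrite -[X in is_true X]/(_ \in @tensor_relb R B F).
  by rewrite (Quotient.idealrBE (@tensor_relb R B F)) reprK.
have lamB t t' : lam (t - t') = lam t - lam t'.
  by rewrite -[t]reprK -[t']reprK -raddfB !lam_pi gamB.
have lamU b x : lam (tmul b x) = ev (g b) x by rewrite /tmul lam_pi gamU.
have key t : lam (tensor_map f t) = i t.
  apply: (tensor_ext (f := lam \o @tensor_map R A B F f)) => [u v|u v|a0 x] /=.
  - by rewrite tensor_map_is_zmod_morphism lamB.
  - exact: (linearB i).
  by rewrite tensor_map_tmul lamU gE mklinE aE.
by move=> t t' ft; apply: iI; rewrite -!key ft.
Qed.

End Flat.

(** * Syzygies of injective modules are flat *)

Section FgResolution.
Variable R : pzRingType.

(** A finitely generated module with chosen generators; carrying the generators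
    along keeps the rank of the first term of a resolution under control. *)
Record presented := Presented {
  pres_mod : lmodType R;
  pres_rank : nat;
  pres_map : {linear 'rV[R]_pres_rank -> pres_mod};
  pres_surj : surj_map pres_map }.

Lemma fg_resolution (c : presented) : left_noetherian R ->
  exists2 st : nat -> presented, st 0%N = c &
    forall i, exists j : {linear pres_mod (st i.+1) -> 'rV[R]_(pres_rank (st i))},
      ses j (pres_map (st i)).
Proof.
move=> noeR.
have /choice[nxt nxtP] (d : presented) : exists d' : presented,
    exists j : {linear pres_mod d' -> 'rV[R]_(pres_rank d)}, ses j (pres_map d).
  have [K [j [l [q [jp qS]]]]] := fg_step noeR (@pres_surj d).
  by exists (Presented qS), j.
by exists (fun i => iter i nxt c) => // i; apply: nxtP.
Qed.
End FgResolution.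

Section SyzygyFlat.
Variable R : pzRingType.

(** Baer's problem for Hom_Z(F, D) and the right ideal [J].  Let a_b be the
    generators of [J] given by the resolution.  A solution is an additive map psi
    on [F] with psi(sum of the a_b x_b) = sum of the g(a_b)(x_b).  As [D] is
    injective, it exists if the right-hand side depends only on the sum on the
    left, and since Tor_1(R/J, F) = 0, the relations between the a_b in [F] come
    from relations in the ring, which [g] respects. *)
Lemma tor_vanish_baer (F : lmodType R) (D : lmodType int) (H : lmodType R^c)
    (ev : H -> F -> D) (k : nat -> nat) (S : nat -> lmodType R^c)
    (j : forall i, {linear S i.+1 -> 'rV[R^c]_(k i)})
    (p : forall i, {linear 'rV[R^c]_(k i) -> S i})
    (J : R^c -> Prop) (g : R^c -> H) (o : 'I_(k 0%N)) :
  (forall i, ses (j i) (p i)) -> (forall a : 'I_(k 0%N), a = o) ->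
  (forall v, p 0%N v = 0 <-> J (v 0 o)) ->
  injective_module D ->
  is_hom_module (fun (r : R^c) x => (r : R) *: x) ev ->
  submodule (M := (R^c)^o) J ->
  (forall a r s : R^c, J r -> J s -> g (a * r + s) = a *: g r + g s) ->
  tor_vanish j p F 0 ->
  exists u, forall r : R^c, J r -> g r = r *: u.
Proof.
move=> jp o1 pJ injD [evD evA evZ evX evM] sJ gP torF.
pose d i := diff j p i.
pose a (b : 'I_(k 1%N)) : R^c := d 0%N (delta_mx 0 b) 0 o.
have Ja b : J (a b) by apply/pJ; rewrite (ses_comp0 (jp 0%N)).
have ev0 x : ev 0 x = 0 by apply: (addrI (ev 0 x)); rewrite -evA !addr0.
have ev_sum n (h : 'I_n -> H) x : ev (\sum_i h i) x = \sum_i ev (h i) x.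
  by elim/big_rec2: _ => // i u v _ <-; rewrite evA.
have ev_sumr n h (x : 'I_n -> F) : ev h (\sum_i x i) = \sum_i ev h (x i).
  elim/big_rec2: _ => [|i u v _ <-]; last by rewrite evD.
  by apply: (addrI (ev h 0)); rewrite -evD !addr0.
pose V : lmodType int := ('I_(k 1%N) -> zmodule F).
have lA : linear (fun x : V => tens (d 0%N) (x : _ -> F) o : zmodule F).
  apply: additive_linear => x y; rewrite /tens -big_split; apply: eq_bigr => b _.
  exact: (scalerDr (d 0%N (delta_mx 0 b) 0 o : R) (x b : F) (y b : F)).
have lPhi : linear (fun x : V => \sum_b ev (g (a b)) (x b) : D).
  apply: additive_linear => x y; rewrite -big_split; apply: eq_bigr => b _.
  exact: evD.
have [|psi psiE] := @injective_extend _ _ _ _ (mklin lA) (mklin lPhi) injD.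
  move=> x; rewrite !mklinE => x0.
  have [|y yE] := torF x; first by move=> c; rewrite (o1 c).
  under eq_bigr do rewrite yE ev_sumr.
  rewrite exchange_big big1 // => c _.
  under eq_bigr do rewrite -evZ; rewrite -ev_sum.
  rewrite -(ideal_map_sum (fun b => d 1%N (delta_mx 0 c) 0 b) sJ gP Ja).
  rewrite (_ : \sum_i _ = 0) ?(ideal_map0 sJ gP) ?ev0 //.
  transitivity (d 0%N (d 1%N (delta_mx 0 c)) 0 o); last by rewrite (diff_diff jp) mxE.
  by rewrite (rV_linE (d 0%N)) summxE; apply: eq_bigr => b _; rewrite mxE.
have [|u uE] := evM psi; first exact: (linearD psi).
exists u => r Jr; apply: evX => x; rewrite evZ uE.
have [v vE] : exists v, d 0%N v = const_mx r.
  have [_ pS _] := jp 1%N; have [_ _ jpE] := jp 0%N.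
  have /jpE[s <-] : p 0%N (const_mx r) = 0 by apply/pJ; rewrite mxE.
  by have [v <-] := pS s; exists v.
have rE : r = \sum_b v 0 b * a b.
  have -> : r = (const_mx r : 'rV[R^c]_(k 0%N)) 0 o by rewrite mxE.
  by rewrite -vE (rV_linE (d 0%N)) summxE; apply: eq_bigr => b _; rewrite mxE.
rewrite {1}rE (ideal_map_sum _ sJ gP Ja) ev_sum.
transitivity (mklin lPhi (fun b => (v 0 b : R) *: x)).
  by rewrite mklinE; apply: eq_bigr => b _; rewrite evZ.
rewrite -psiE mklinE; congr (psi _).
rewrite {1}rE /tens scaler_suml; apply: eq_bigr => b _.
by rewrite scalerA.
Qed.

(** Tor_1(R/J, K) = Tor_(m+1)(R/J, I) is dual to Ext^(m+1)(R/J, R), hence zero for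
    every right ideal [J]. *)
Lemma syzygy_flat n I m K : right_noetherian R ->
  inj_dim_le n ((R^c)^o : lmodType R^c) -> injective_module I -> (n <= m)%N ->
  syzygy I m K -> flat (R := R) K.
Proof.
move=> noeR idR injI nm sK; apply: hom_injective_flat => D H ev injD evP.
apply: baer_injective => J g sJ gP.
have sJ1 : submodule (fun v : 'rV[R^c]_1 => J (v 0 0)).
  have [J0 JD JZ] := sJ.
  split=> [|v w Jv Jw|r v Jv]; rewrite mxE //; [exact: JD|exact: JZ].
have [C [q [qS qE]]] := quotient_module sJ1.
have [st st0 stP] := fg_resolution (Presented qS) noeR.
pose j i := projT1 (cid (stP i)).
have jp i : ses (j i) (pres_map (st i)) := projT2 (cid (stP i)).
have [o [o1 oJ]] : exists o : 'I_(pres_rank (st 0%N)), (forall a, a = o) /\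
    forall v, pres_map (st 0%N) v = 0 <-> J (v 0 o).
  by rewrite st0 /=; exists 0; split=> // a; rewrite ord1.
apply: (tor_vanish_baer jp o1 oJ injD evP sJ gP).

apply: (tor_vanish_syzygy jp injI _ nm sK) => i ni.
apply: (syzygy_ext (inj_dim_le_mono ni idR)).
suff : syzygy (pres_mod (st 0%N)) i (pres_mod (st i)) by apply.
elim: i {ni} => [|i IH]; first exact: syzygy0.
by apply: (syzygyS IH _ (jp i)); apply: rV_projective.
Qed.

End SyzygyFlat.

(** * Resolutions and dimensions *)

Section Resolutions.
Variable R : pzRingType.
Implicit Types M N G I P F K L Q : lmodType R.
Implicit Type C : lmodType R -> Prop.

Lemma rV0_eq0 (x : 'rV[R]_0) : x = 0.
Proof. exact: thinmx0. Qed.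

(** Naming this family lets the module structure of its terms be inferred when
    the index is not a constructor. *)
Definition family_cons M (H : nat -> lmodType R) (i : nat) : lmodType R :=
  if i is i'.+1 then H i' else M.

Lemma left_resolution_base C M : C M -> has_left_resolution C M 0.
Proof.
move=> CM; exists (family_cons M (fun=> 'rV[R]_0)).
exists (fun i => \0), idfun; split=> [[]//|[]// i _ x|y|v|i v].
- exact: rV0_eq0.
- by exists y.
- by split=> [/= ->|[u <-] //]; exists 0.
- by split=> _; [exists 0; rewrite [RHS]rV0_eq0|].
Qed.

Lemma left_resolution_cons C M N G k (j : {linear N -> G}) (p : {linear G -> M}) :
  ses j p -> C G -> has_left_resolution C N k -> has_left_resolution C M k.+1.
Proof.
move=> [jI pS jp] CG [H [d [e [CH H0 eS ex0 ex]]]].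
exists (family_cons G H).
exists (fun i => match i return
  {linear family_cons G H i.+1 -> family_cons G H i} with
  | 0%N => j \o e | i'.+1 => d i' end), p.
split=> [[|i] ik|[|i] ik x|y|v|[|i] v] //.
- exact: CH.
- by apply: H0.
- rewrite jp; split=> [[u <-]|[u <-]]; last by exists (e u).
  by have [w <-] := eS u; exists w.
- rewrite -ex0 /=; split=> [ev0|->]; last by rewrite linear0.
  by apply: jI; rewrite linear0.
- exact: ex.
Qed.

(** The new augmentation is the corestriction of the first differential to the
    kernel of the given one. *)
Lemma left_resolution_uncons C M k : has_left_resolution C M k.+1 ->
  exists N G (j : {linear N -> G}) (p : {linear G -> M}),
    [/\ C G, ses j p & has_left_resolution C N k].
Proof.
move=> [H [d [e [CH H0 eS ex0 ex]]]].
have [K [j jp]] := ses_kernel eS; have [jI _ jpE] := jp.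
have [|e' e'E] := @factor_mono _ _ _ _ j (d 0%N) jI.
  by move=> y; apply/jpE/ex0; exists y.
exists K, (H 0%N), j, e; split=> //; first exact: CH.
exists (fun i => H i.+1), (fun i => d i.+1), e'; split=> [i ik|i ik|y|v|i] //.
- exact: CH.
- exact: H0.
- have /ex0[u uE] : e (j y) = 0 by apply/jpE; exists y.
  by exists u; apply: jI; rewrite e'E.
- rewrite -ex -e'E; split=> [->|]; first by rewrite linear0.
  by move=> ?; apply: jI; rewrite linear0.
Qed.

Lemma left_resolution0 C M : has_left_resolution C M 0 ->
  exists2 G, C G & exists e : {linear G -> M}, injective e /\ surj_map e.
Proof.
move=> [H [d [e [CH H0 eS ex0 ex]]]]; exists (H 0%N); first exact: CH.
exists e; split=> //; apply: inj0P => x /ex0[u <-].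
by rewrite (H0 1%N isT u) linear0.
Qed.

Lemma right_resolution_base C M : C M -> has_right_resolution C M 0.
Proof.
move=> CM; exists (family_cons M (fun=> 'rV[R]_0)).
exists (fun i => \0), idfun; split=> [[]//|[]// i _ x|//|v|i v].
- exact: rV0_eq0.
- by split=> // _; exists v.
- split=> [_|_]; last exact: rV0_eq0.
  by exists 0; rewrite [RHS]rV0_eq0.
Qed.

Lemma right_resolution_cons C M I N k (j : {linear M -> I}) (p : {linear I -> N}) :
  ses j p -> C I -> has_right_resolution C N k -> has_right_resolution C M k.+1.
Proof.
move=> [jI pS jp] CG [H [d [e [CH H0 eI ex0 ex]]]].
exists (family_cons I H).
exists (fun i => match i return
  {linear family_cons I H i -> family_cons I H i.+1} with
  | 0%N => e \o p | i'.+1 => d i' end), j.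
split=> [[|i] ik|[|i] ik x|//|v|[|i] v] //.
- exact: CH.
- by apply: H0.
- rewrite -jp /=; split=> [ev0|->]; last by rewrite linear0.
  by apply: eI; rewrite linear0.
- rewrite ex0; split=> [[u <-]|[u <-]]; last by exists (p u).
  by have [w <-] := pS u; exists w.
- exact: ex.
Qed.

(** The new augmentation is the map induced by the first differential on the
    cokernel of the given one. *)
Lemma right_resolution_uncons C M k : has_right_resolution C M k.+1 ->
  exists I N (j : {linear M -> I}) (p : {linear I -> N}),
    [/\ C I, ses j p & has_right_resolution C N k].
Proof.
move=> [H [d [e [CH H0 eI ex0 ex]]]].
have [N [p jp]] := ses_cokernel eI; have [_ pS jpE] := jp.
have [|e' e'E] := @factor_epi _ _ _ _ p (d 0%N) pS.
  by move=> y /jpE/ex0.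
exists (H 0%N), N, e, p; split=> //; first exact: CH.
exists (fun i => H i.+1), (fun i => d i.+1), e'; split=> [i ik|i ik||v|i] //.
- exact: CH.
- exact: H0.
- apply: inj0P => x; have [y <-] := pS x; rewrite e'E => /ex0/jpE //.
- rewrite ex; split=> [[u <-]|[u <-]]; first by exists (p u); rewrite e'E.
  by have [y <-] := pS u; exists y; rewrite e'E.
Qed.

Lemma right_resolution0 C M : has_right_resolution C M 0 ->
  exists2 I, C I & exists e : {linear M -> I}, injective e /\ surj_map e.
Proof.
move=> [H [d [e [CH H0 eI ex0 ex]]]]; exists (H 0%N); first exact: CH.
by exists e; split=> // y; apply/ex0; exact: H0.
Qed.

Lemma inverse_exists M N (e : {linear M -> N}) : injective e -> surj_map e ->
  exists h : {linear N -> M}, cancel h e /\ cancel e h.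
Proof.
move=> eI eS; have [|h hE] := @factor_mono _ _ _ _ e (idfun : {linear N -> N}) eI.
  by move=> y; apply: eS.
by exists h; split=> // x; apply: eI; rewrite hE.
Qed.

Lemma right_resolution_inj_dim k M :
  has_right_resolution (@injective_module R) M k <-> inj_dim_le k M.
Proof.
elim: k M => [|k IH] M; split.
- move=> /right_resolution0[I injI [e [eI eS]]].
  have [h [_ he]] := inverse_exists eI eS.
  by apply: retract_injective injI; exists e, h.
- exact: right_resolution_base.
- by move=> /right_resolution_uncons[I [N [j [p [injI jp /IH]]]]]; exists I, N, j, p.
- by move=> [I [N [j [p [injI jp /IH]]]]]; apply: right_resolution_cons jp injI.
Qed.

Lemma inj_dimP k M : enat_le (inj_dim M) (Some k) <-> inj_dim_le k M.
Proof.
rewrite enat_least_le; split=> [[i ik /right_resolution_inj_dim]|].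
  exact: inj_dim_le_mono.
by exists k => //; apply/right_resolution_inj_dim.
Qed.

Fixpoint ding_dim_le k M : Prop :=
  if k is k'.+1 then
    exists N G (j : {linear N -> G}) (p : {linear G -> M}),
      [/\ ding_projective G, ses j p & ding_dim_le k' N]
  else ding_projective M.

Lemma ding_projective_iso M N (e : {linear M -> N}) :
  injective e -> surj_map e -> ding_projective M -> ding_projective N.
Proof.
move=> eI eS [P [d [projP dE dF [i [j [jI jd]]]]]].
have [h [eh he]] := inverse_exists eI eS.
exists P, d; split=> //; exists i, (j \o h); split=> [x y /= /jI/(can_inj eh)//|v].
rewrite jd; split=> [[u <-]|[u <-]]; last by exists (h u).
by exists (e u); rewrite /= he.
Qed.

Lemma left_resolution_ding k M :
  has_left_resolution (@ding_projective R) M k <-> ding_dim_le k M.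
Proof.
elim: k M => [|k IH] M; split.
- by move=> /left_resolution0[G dG [e [eI eS]]]; apply: (ding_projective_iso eI eS dG).
- exact: left_resolution_base.
- by move=> /left_resolution_uncons[I [N [j [p [injI jp /IH]]]]]; exists I, N, j, p.
- by move=> [I [N [j [p [injI jp /IH]]]]]; apply: left_resolution_cons jp injI.
Qed.

Lemma ding_proj_dimP k M : enat_le (ding_proj_dim M) (Some k) <->
  exists2 i, (i <= k)%N & ding_dim_le i M.
Proof.
rewrite enat_least_le; split=> -[i ik].
  by move=> /left_resolution_ding; exists i.
by exists i => //; apply/left_resolution_ding.
Qed.

End Resolutions.

(** * Complete resolutions by projective modules *)

Section Ding.
Variable R : pzRingType.
Implicit Types A B C M N G I P F K L Q : lmodType R.

(** Descend along the complex: a cycle is a syzygy of the next one. *)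
Lemma ding_syzygy M m : ding_projective M -> exists A, syzygy A m M.
Proof.
move=> [P [d [projP dE _ [i [j [jI jd]]]]]].
elim: m M i j jI jd => [|m IH] M i j jI jd; first by exists M; constructor.
(* The index i is replaced by i' + 1, for the differential out of P i to be d i'. *)
have {j jI jd} [i' [j [jI jd]]] : exists (i' : int) (j : {linear M -> P (i' + 1 + 1)}),
    injective j /\ exact_at j (d (i' + 1)).
  by exists (i - 1); rewrite subrK; exists j.
have [K [t [tI td]]] := kernel_exists (d i').
have [|p pE] := @factor_mono _ _ _ _ t (d (i' + 1)) tI.
  by move=> y; apply/td/dE; exists y.
have [A sA] := IH K i' t tI td.
exists A; apply: (syzygyS sA (projP _) (j := j) (p := p)); split=> // [y|v].
  have /dE[u uE] : d i' (t y) = 0 by apply/td; exists y.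
  by exists u; apply: tI; rewrite pE.
rewrite -jd -pE; split=> [->|]; first by rewrite linear0.
by move=> ?; apply: tI; rewrite linear0.
Qed.

(** An exact complex [Q] of projective modules with cycles [Z], cut into short
    exact sequences. *)
Definition projective_chain (Z Q : int -> lmodType R) :=
  (forall i, projective (Q i)) /\
  forall i, exists (j : {linear Z (i + 1) -> Q i}) (p : {linear Q i -> Z i}), ses j p.

Lemma projective_chain_syzygy (Z Q : int -> lmodType R) m i : projective_chain Z Q ->
  exists A, syzygy A m (Z i).
Proof.
move=> [projQ sZ]; elim: m i => [|m IH] i; first by exists (Z i); constructor.
rewrite -[i](subrK 1); have [A sA] := IH (i - 1); have [j [p jp]] := sZ (i - 1).
by exists A; apply: syzygyS sA (projQ _) jp.
Qed.

(** [Z i] is a syzygy of any order, so Ext^1(Z i, F) = 0 for [F] of finite injective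
    dimension, and this gives the exactness of Hom(Q, F). *)
Lemma projective_chain_ding (Z Q : int -> lmodType R) i :
  (forall F, flat F -> exists m, inj_dim_le m F) -> projective_chain Z Q ->
  ding_projective (Z i).
Proof.
move=> flatF ch; have [projQ sZ] := ch.
pose j i := projT1 (cid (sZ i)); pose p i := projT1 (cid (projT2 (cid (sZ i)))).
have jp k : ses (j k) (p k) := projT2 (cid (projT2 (cid (sZ k)))).
pose d k : {linear Q (k + 1) -> Q k} := j k \o p (k + 1).
have dE k v : d k v = 0 <-> p (k + 1) v = 0.
  have [jI _ _] := jp k; split=> [dv|/= ->]; last by rewrite linear0.
  by apply: jI; rewrite linear0.
exists Q, d; split=> // [k v|F /flatF[m idF] k f|].
- have [_ _ jpE] := jp (k + 1); have [_ pS _] := jp (k + 1 + 1).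
  rewrite dE jpE; split=> [[u <-]|[u <-]]; last by exists (p (k + 1 + 1) u).
  by have [w <-] := pS u; exists w.
- split=> [f0|[g gf] x]; last first.
    by rewrite -gf (_ : d k _ = 0) ?linear0 //; apply/dE/(ses_comp0 (jp (k + 1))).
  have [A sA] := projective_chain_syzygy m k ch.
  apply: (hom_exact (jp (k + 1)) (jp k) (syzygy_ext idF sA)) => x.
  by have [_ pS _] := jp (k + 1 + 1); have [w <-] := pS x; apply: f0.
have [k ->] : exists k, i = k + 1 + 1 by exists (i - 1 - 1); rewrite !subrK.
exists k, (j (k + 1)); split; first by have [] := jp (k + 1).
by move=> v; rewrite dE; have [_ _ ->] := jp (k + 1).
Qed.

Lemma inl_linear P Q : linear (fun x : P => (x, 0) : P * Q).
Proof. by move=> a x y; apply: injective_projections; rewrite /= ?scaler0 ?addr0. Qed.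

Lemma inr_linear P Q : linear (fun x : Q => (0, x) : P * Q).
Proof. by move=> a x y; apply: injective_projections; rewrite /= ?scaler0 ?addr0. Qed.

Lemma product_projective P Q : projective P -> projective Q -> projective (P * Q)%type.
Proof.
move=> projP projQ A B p f pS.
have [h1 h1E] := projP _ _ p (f \o mklin (@inl_linear P Q)) pS.
have [h2 h2E] := projQ _ _ p (f \o mklin (@inr_linear P Q)) pS.
exists ((h1 \o fst) \+ (h2 \o snd)) => -[x y] /=.
rewrite linearD h1E h2E /= -linearD; congr (f _).
by apply: injective_projections; rewrite /= ?addr0 ?add0r.
Qed.

(** The constant chain [P -> P * P -> P] avoids a distinction of cases on the
    index. *)
Lemma projective_ding P : (forall F, flat F -> exists m, inj_dim_le m F) ->
  projective P -> ding_projective P.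
Proof.
move=> flatF projP.
apply: (@projective_chain_ding (fun=> P) (fun=> (P * P)%type : lmodType R) 0) => //.
split=> _; first exact: product_projective.
exists (mklin (@inl_linear P P)), snd; split=> [x y [] //|y|[x y]].
  by exists (0, y).
by split=> [/= ->|[u [_ <-]] //]; exists x.
Qed.

(** If [P] covers [K] and [P'] covers [K'], then [P * P'] covers [L], and its kernel
    is an extension of the kernels of the two covers. *)
Lemma horseshoe M I N (j : {linear M -> I}) (p : {linear I -> N}) k K :
  ses j p -> syzygy M k K ->
  exists L K' (u : {linear K -> L}) (v : {linear L -> K'}),
    [/\ syzygy I k L, syzygy N k K' & ses u v].
Proof.
move=> jp; elim=> {k K} [|k K P K1 t q sK [L [K' [u [v [sL sK' uv]]]]] projP tq].
  by exists I, N, j, p; split=> //; constructor.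
have [q' q'S] := free_cover K'; set P' := fsup _ _ in q' q'S.
have projP' : projective P' by apply: fsup_projective.
have [uI vS uvE] := uv; have [tI qS tqE] := tq.
have [l lE] := projP' _ _ v q' vS.
pose pi : {linear (P * P')%type -> L} := (u \o q \o fst) \+ (l \o snd).
have piE z : pi z = u (q z.1) + l z.2 by [].
have piS : surj_map pi.
  move=> y; have [b bE] := q'S (v y).
  have /uvE[x xE] : v (y - l b) = 0 by rewrite linearB /= lE bE subrr.
  by have [a aE] := qS x; exists (a, b); rewrite piE /= aE xE subrK.
have [L1 [t1 t1p]] := ses_kernel piS; have [t1I _ t1E] := t1p.
have [K1' [t2 t2q]] := ses_kernel q'S; have [t2I _ t2E] := t2q.
have [|w wE] := @factor_mono _ _ _ _ t2 (snd \o t1) t2I.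
  move=> z; apply/t2E; rewrite -lE /=.
  have := ses_comp0 t1p z; rewrite piE => /(congr1 v).
  by rewrite linearD /= (ses_comp0 uv) add0r linear0.
have l1 : linear (fun x : K1 => (t x, 0) : P * P').
  by move=> a x y; rewrite linearP inl_linear.
have [|h hE] := @factor_mono _ _ _ _ t1 (mklin l1) t1I.
  by move=> x; apply/t1E; rewrite piE /= (ses_comp0 tq) !linear0 addr0.
exists L1, K1', h, w; split.
- by apply: (syzygyS sL _ t1p); apply: product_projective.
- by apply: (syzygyS sK' _ t2q).
split=> [x y /(congr1 t1)|y|z].
- by rewrite !hE => -[/tI].
- have q'0 := ses_comp0 t2q y.
  have /uvE[x xE] : v (l (t2 y)) = 0 by rewrite lE.
  have [a aE] := qS x.
  have /t1E[z zE] : pi (- a, t2 y) = 0 by rewrite piE /= !linearN /= aE xE addNr.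
  by exists z; apply: t2I; rewrite wE /= zE.
split=> [w0|[x <-]]; last by apply: t2I; rewrite wE /= hE linear0.
have z2 : (t1 z).2 = 0 by rewrite -[LHS]wE w0 linear0.
have := ses_comp0 t1p z; rewrite piE z2 linear0 addr0 => uq0.
have /tqE[x xE] : q (t1 z).1 = 0 by apply: uI; rewrite linear0.
exists x; apply: t1I; rewrite hE mklinE xE [RHS]surjective_pairing z2 //.
Qed.

(** The left half of the chain is made of free covers.  For the right half, the
    data carried along is that the current module is an [s]-th syzygy of some [N]:
    by [horseshoe], applied to an embedding of [N] in an injective module, it
    embeds in a projective module with a cokernel of the same kind. *)
Lemma syzygy_chain s M K :
  (forall I L, injective_module I -> syzygy I s L -> projective L) ->
  syzygy M s K -> exists Z Q : int -> lmodType R, projective_chain Z Q /\ Z 0 = K.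
Proof.
move=> injS sK.
have /choice[rgt rgtP] (C : {C | exists M, syzygy M s C}) :
    exists q : {C | exists M, syzygy M s C} * lmodType R,
      projective q.2 /\
      exists (j : {linear (sval C) -> q.2}) (p : {linear q.2 -> (sval q.1)}), ses j p.
  case: C => C [N sC]; have [I [e [eI injI]]] := enough_injectives N.
  have [N' [e' ee']] := ses_cokernel eI.
  have [L [C' [u [v [sL sC' uv]]]]] := horseshoe ee' sC.
  exists (exist _ C' (ex_intro _ N' sC'), L); split; first exact: (injS I).
  by exists u, v.
have /choice[lft lftP] C : exists q : lmodType R * lmodType R,
    projective q.2 /\ exists (j : {linear q.1 -> q.2}) (p : {linear q.2 -> C}), ses j p.
  have [p pS] := free_cover C; have [L [j jp]] := ses_kernel pS.
  by exists (L, fsup C (R^o : lmodType R)); split; [apply: fsup_projective|exists j, p].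
pose zl k := iter k (fun C => (lft C).1) K.
pose zr k := iter k (fun c => (rgt c).1) (exist _ K (ex_intro _ M sK)).
exists (fun i => match i with Posz k => zl k | Negz k => sval (zr k.+1) end).
exists (fun i => match i with Posz k => (lft (zl k)).2 | Negz k => (rgt (zr k)).2 end).
split=> //; split=> [[k|k]|[k|k]].
- by have [] := lftP (zl k).
- by have [] := rgtP (zr k).
- by rewrite -PoszD addn1; have [] := lftP (zl k).
rewrite (_ : Negz k + 1 = - k%:Z); last by rewrite NegzE -addn1 PoszD opprD addrNK.
have [_] := rgtP (zr k); case: k => [|k]; first by rewrite oppr0.
by rewrite -NegzE.
Qed.

Lemma syzygy_ding_dim_le k t M K : (forall F, flat F -> exists m, inj_dim_le m F) ->
  syzygy M k K -> ding_dim_le t K -> ding_dim_le (k + t) M.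
Proof.
move=> flatF sK; elim: sK t => {k K} [//|k K P L j p sK IH projP jp] t dL.
rewrite addSnnS; apply: (IH t.+1); exists L, P, j, p; split=> //.
exact: projective_ding.
Qed.

(** This is Ext^(i+1)(M, B) = 0 for [C] an [i]-th cosyzygy of [B]: one shifts
    dimensions in both variables, and Ding projective modules have no
    extensions by modules of finite injective dimension. *)
Lemma ding_dim_ext k i a M C : ding_dim_le k M -> cosyzygy i C -> (k <= i)%N ->
  inj_dim_le a C -> ext_vanish M C.
Proof.
elim: k i a M C => [|k IH] i a M C.
  move=> dM _ _ idC; have [A sA] := ding_syzygy a dM; exact: syzygy_ext idC sA.
move=> [N [G [j [p [dG jp dN]]]]]; case: i => // i [K [I [u [v [cK injI uv]]]]] ki idC.
have eNK : ext_vanish N K by apply: (IH i a.+1) => //; exists I, C, u, v.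
have [A sA] := ding_syzygy a dG.
apply: (ext_of_cover jp (syzygy_ext idC sA)) => f.
have [g gE] := ext_lift f uv eNK.
have [jI _ _] := jp; have [h hE] := injI _ _ j g jI.
by exists (v \o h) => x /=; rewrite hE gE.
Qed.

(** The last step of an injective resolution of [B] is an extension of an
    injective module by a cosyzygy of order at least [k], so it splits and can be
    removed. *)
Lemma inj_dim_descend k i a B : (forall M, exists2 l, (l <= k)%N & ding_dim_le l M) ->
  cosyzygy i B ->
  (k <= i + a)%N -> inj_dim_le a.+1 B -> inj_dim_le a B.
Proof.
move=> dimk; elim: a i B => [|a IH] i B cB ki idB.
  have [I [N [j [p [injI jp injN]]]]] := idB.
  have [l lk dN] := dimk N; rewrite addn0 in ki.
  have eNB : ext_vanish N B := ding_dim_ext dN cB (leq_trans lk ki) idB.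
  exact: (retract_injective (ext_split_sub jp eNB)).
have [I [N [j [p [injI jp idN]]]]] := idB; exists I, N, j, p; split=> //.
by apply: (IH i.+1) => //; [exists B, I, j, p|rewrite addSnnS].
Qed.

End Ding.

(** Injective modules have projective dimension at most [s]; here [n] bounds
    id(R_R), and [m] the injective dimensions of flat modules. *)
Lemma injective_syzygy_projective (R : pzRingType) n m s (I L : lmodType R) :
  left_noetherian R -> right_noetherian R ->
  inj_dim_le s (R^o : lmodType R) -> inj_dim_le n ((R^c)^o : lmodType R^c) ->
  (forall F : lmodType R, flat F -> inj_dim_le m F) ->
  injective_module I -> syzygy I s L -> projective L.
Proof.
move=> noeL noeR idR idRc idF injI.
(* The next syzygy is flat, hence of injective dimension at most m, and the order
   of K is at least m, so the next step of the resolution splits. *)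
have top (K : lmodType R) : syzygy I (s + (n + m)) K -> projective K.
  move=> sK; have [q qS] := free_cover K; have [L' [t tq]] := ses_kernel qS.
  have sL' : syzygy I (s + (n + m)).+1 L'.
    by apply: (syzygyS sK _ tq); apply: fsup_projective.
  have fL' : flat L'.
    by apply: (syzygy_flat noeR idRc injI _ sL'); rewrite addnCA leqW // leq_addr.
  have eKL' : ext_vanish K L'.
    apply: (syzygy_ext (inj_dim_le_mono _ (idF _ fL')) sK).
    by rewrite addnA leq_addl.
  by apply: (retract_projective (ext_split_quotient tq eKL')); apply: fsup_projective.
(* As long as the order is at least s, one step less is enough, because the
   next syzygy is a summand of a free module, and id(free) <= s. *)
elim: (n + m)%N top L => [|c IH] top L; first by rewrite -{1}[s]addn0; apply: top.
apply: IH => K sK.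
have [q qS] := free_cover K; have [L' [t tq]] := ses_kernel qS.
have projL' : projective L'.
  by apply: top; rewrite addnS; apply: (syzygyS sK _ tq); apply: fsup_projective.
have [q' q'S] := free_cover L'; have [r rE] := projL' _ _ q' idfun q'S.
have eKL' : ext_vanish K L'.
  apply: (ext_retract (B := fsup L' (R^o : lmodType R))); first by exists r, q'.
  apply: (syzygy_ext _ sK); apply: (inj_dim_le_mono (leq_addr c s)).
  exact: fsup_inj_dim.
by apply: (retract_projective (ext_split_quotient tq eKL')); apply: fsup_projective.
Qed.

Theorem proposition3p9 (n : nat) (R : pzRingType) (hR : gorenstein n R)
    (hflat : class_inj_dim (@flat R) <> None) :
  enat_le (left_global_ding_proj_dim R) (Some n) /\
  left_global_ding_proj_dim R = inj_dim (R^o : lmodType R).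
Proof.
have [noeL noeR idRn /inj_dimP idRc] := hR.
have [m idF] : exists m, forall F : lmodType R, flat F -> inj_dim_le m F.
  case mE: (class_inj_dim _) hflat => [m|//] _; exists m => F fF; apply/inj_dimP.
  have /enat_sup_le ub : enat_le (class_inj_dim (@flat R)) (Some m) by rewrite mE /=.
  by apply: ub; exists F.
have [s sE] : exists s, inj_dim (R^o : lmodType R) = Some s.
  by case: (inj_dim _) idRn => [s|//] _; exists s.
have flatF (F : lmodType R) : flat F -> exists m, inj_dim_le m F by move=> /idF; exists m.
have idRs : inj_dim_le s (R^o : lmodType R) by apply/inj_dimP; rewrite sE /=.
have ding_s (M : lmodType R) : ding_dim_le s M.
  have [K sK] := syzygy_exists M s; rewrite -[s]addn0.
  apply: (syzygy_ding_dim_le flatF sK) => /=.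
  have [I L|Z [Q [ch <-]]] := syzygy_chain _ sK.
    exact: injective_syzygy_projective noeL noeR idRs idRc idF.
  exact: projective_chain_ding ch.
have le_s : enat_le (left_global_ding_proj_dim R) (Some s).
  by apply/enat_sup_le => _ [M ->]; apply/ding_proj_dimP; exists s.
split.
  case: (left_global_ding_proj_dim R) le_s => // g /= gs.
  by apply: leq_trans gs _; rewrite sE in idRn.
rewrite sE; case gE: (left_global_ding_proj_dim R) le_s => [g|//] /= gs.
congr Some; apply/eqP; rewrite eqn_leq gs /=.
have ding_g (M : lmodType R) : exists2 i, (i <= g)%N & ding_dim_le i M.
  apply/ding_proj_dimP.
  have /enat_sup_le ub : enat_le (left_global_ding_proj_dim R) (Some g) by rewrite gE /=.
  by apply: ub; exists M.
have desc c : inj_dim_le (g + c) (R^o : lmodType R) -> inj_dim_le g (R^o : lmodType R).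
  elim: c => [|c IH]; rewrite ?addn0 // addnS => idR; apply: IH.
  by apply: (inj_dim_descend (i := 0%N) ding_g _ _ idR); rewrite ?leq_addr.
have [//|gs'] := orP (leq_total s g).
suff : enat_le (inj_dim (R^o : lmodType R)) (Some g) by rewrite sE.
by apply/inj_dimP/(desc (s - g)%N); rewrite subnKC.
Qed.
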